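(* Let $V$ be an object of $\mathcal I^{fin}$. Then $V$ is isomorphic to a direct sum of indecomposable modules. More precisely, there exist $L^e(\mathfrak g)$-submodules $U_1,U_2$ of $V$ such that $V=U_1\oplus U_2$, $U_1\subset V^{L(\mathfrak g)}$ and $U_2^+=V^+$. Moreover, $U_2$ is isomorphic to a finite direct sum of indecomposable modules.
   Context: $\mathfrak g$ is a complex finite-dimensional simple Lie algebra with Cartan subalgebra $\mathfrak h$, simple roots $\alpha_i$ ($i\in I$), positive roots $R^+$, weight lattice $P$, dominant weights $P^+$, Weyl group $W$, highest root $\theta$; $\alpha^\vee\in\mathfrak h$ denotes the coroot of $\alpha$; $x_\alpha^\pm$ ($\alpha\in R^+$) is a nonzero element of the root space $\mathfrak g_{\pm\alpha}$; $\mathfrak n^+=\bigoplus_{\alpha\in R^+}\mathfrak g_\alpha$. For a Lie algebra $\mathfrak a$, $L(\mathfrak a)=\mathfrak a\otimes\mathbb C[t,t^{-1}]$ with $[x\otimes f,y\otimes g]=[x,y]\otimes fg$, and $L^e(\mathfrak a)=L(\mathfrak a)\oplus\mathbb Cd$ with $[d,x\otimes t^n]=n\,x\otimes t^n$. Set $\mathfrak h_e=\mathfrak h\oplus\mathbb Cd$; $\delta\in\mathfrak h_e^*$ is given by $\delta(d)=1$, $\delta(\mathfrak h)=0$; $\mathfrak h^*\subset\mathfrak h_e^*$ by setting $\lambda(d)=0$. $P_e=P\oplus\mathbb Z\delta$, $P_e^+=P^+\oplus\mathbb Z\delta$. An $L^e(\mathfrak g)$-module $V$ is integrable if $V=\bigoplus_{\mu\in\mathfrak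 h_e^*}V_\mu$ (weight spaces for $\mathfrak h_e$) and all $x_\alpha^\pm\otimes t^s$ ($\alpha\in R^+$, $s\in\mathbb Z$) act locally nilpotently. $\mathcal I^{fin}$ is the category of integrable $L^e(\mathfrak g)$-modules all of whose weights lie in $P_e$ and all of whose weight spaces are finite-dimensional. $V^{L(\mathfrak g)}=\{v\in V: L(\mathfrak g)v=0\}$. For $0\ne\lambda\in P^+$ let $r_\lambda=\min\{\lambda(h): h\in\mathbb Z(W\theta^\vee),\ \lambda(h)>0\}$, where $\mathbb Z(W\theta^\vee)$ is the $\mathbb Z$-span of the orbit $W\theta^\vee$; for $\lambda=\mu+s\delta$ with $0\neq\mu\in P^+$, $s\in\mathbb Z$, put $r_\lambda=r_\mu$. For $\lambda\in P_e^+\setminus\mathbb Z\delta$ put $V_\lambda^+=\{v\in V_\lambda: L(\mathfrak n^+)v=0\}$, and $V^+=\bigoplus V_\lambda^+$, the sum being over $\lambda\in P_e^+\setminus\mathbb Z\delta$ with $0\le\lambda(d)<r_\lambda$. *)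

(* Defs.v *)
From HB Require Import structures.
From mathcomp Require Import all_boot all_order all_algebra.
From mathcomp Require Import finmap all_classical.

Set Implicit Arguments.
Unset Strict Implicit.
Unset Printing Implicit Defensive.

Import Order.TTheory GRing.Theory Num.Theory.
Local Open Scope classical_set_scope.
Local Open Scope ring_scope.

HB.mixin Record isLieAlgebra (K : fieldType) L of GRing.Lmodule K L := {
  lie : L -> L -> L;
  lie_linearl : forall y, linear (lie^~ y);
  lie_linearr : forall x, linear (lie x);
  lie_alt : forall x, lie x x = 0;
  lie_jacobi : forall x y z,
    lie x (lie y z) + lie y (lie z x) + lie z (lie x y) = 0
}.

#[short(type="lieAlgType")]
HB.structure Definition LieAlgebra (K : fieldType) :=
  {L of GRing.Lmodule K L & isLieAlgebra K L}.

#[short(type="finLieAlgType")]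
HB.structure Definition FinLieAlgebra (K : fieldType) :=
  {L of Vector K L & isLieAlgebra K L}.

Arguments lie {K s} x y.

Reserved Notation "[lie x , y ]" (at level 0, format "[lie  x ,  y ]").
Notation "[lie x , y ]" := (lie x y) : ring_scope.

Section LieTheory.
Variables (K : fieldType) (L : lieAlgType K).
Implicit Types x y z : L.

HB.instance Definition _ x :=
  GRing.isLinear.Build K L L *:%R (lie x) (lie_linearr x).

Definition rlie y x := [lie x, y].
HB.instance Definition _ y :=
  GRing.isLinear.Build K L L *:%R (rlie y) (lie_linearl y).

Lemma lie0r x : [lie 0, x] = 0. Proof. exact: (linear0 (rlie x)). Qed.
Lemma lier0 x : [lie x, 0] = 0. Proof. exact: linear0. Qed.
Lemma lieDl x y z : [lie x + y, z] = [lie x, z] + [lie y, z].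
Proof. exact: (linearD (rlie z)). Qed.
Lemma lieDr x y z : [lie x, y + z] = [lie x, y] + [lie x, z].
Proof. exact: linearD. Qed.
Lemma lierN x y : [lie x, - y] = - [lie x, y].
Proof. exact: linearN. Qed.
Lemma lieZl (a : K) x y : [lie a *: x, y] = a *: [lie x, y].
Proof. exact: (linearZ_LR (rlie y)). Qed.
Lemma lieZr (a : K) x y : [lie x, a *: y] = a *: [lie x, y].
Proof. exact: linearZ_LR. Qed.

Lemma lieC x y : [lie x, y] = - [lie y, x].
Proof.
apply/eqP; rewrite -addr_eq0; apply/eqP.
by have := lie_alt (x + y); rewrite lieDl !lieDr !lie_alt add0r addr0.
Qed.

End LieTheory.

(* An element of L(g) = g (x) K[t,t^-1] is the finitely supported function
   n |-> f n standing for \sum_n (f n) (x) t^n. *)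
Section Loop.
Variables (K : fieldType) (g : lieAlgType K).

Definition loop_pred : {pred int -> g} :=
  fun f => `[< finite_set [set n | f n != 0] >].

Lemma loop_submod_closed : submod_closed loop_pred.
Proof.
split.
  apply/asboolP; apply: (@sub_finite_set _ _ set0); last exact: finite_set0.
  by move=> n /= /eqP; case.
move=> a f h /asboolP ff /asboolP fh; apply/asboolP.
apply: (@sub_finite_set _ _ ([set n | f n != 0] `|` [set n | h n != 0])).
  move=> n /= nz; case: (eqVneq (f n) 0) => [f0|]; last by left.
  right; apply: contra_neq nz => h0.
  by rewrite /GRing.add /= /GRing.scale /= f0 h0 scaler0 addr0.
by rewrite finite_setU.
Qed.

HB.instance Definition _ :=
  GRing.isSubmodClosed.Build K (int -> g) loop_pred loop_submod_closed.

Record loop := Loop { loop_fun :> int -> g; _ : loop_fun \in loop_pred }.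

HB.instance Definition _ := [isSub for loop_fun].
HB.instance Definition _ := [Choice of loop by <:].
HB.instance Definition _ := [SubChoice_isSubLmodule of loop by <:].

Implicit Types f h : loop.

Lemma loop_finite f : finite_set [set n | f n != 0].
Proof. by case: f => f /= /asboolP. Qed.

Lemma loopP f h : (forall n, f n = h n) -> f = h.
Proof. by move=> e; apply: val_inj; apply/funext. Qed.

Lemma loop0E n : (0 : loop) n = 0. Proof. by []. Qed.
Lemma loopDE f h n : (f + h) n = f n + h n. Proof. by []. Qed.
Lemma loopNE f n : (- f) n = - f n. Proof. by []. Qed.
Lemma loopZE (a : K) f n : (a *: f) n = a *: f n. Proof. by []. Qed.

Lemma loop_sumE (I : Type) (r : seq I) (P : pred I) (F : I -> loop) n :
  (\sum_(i <- r | P i) F i) n = \sum_(i <- r | P i) F i n.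
Proof. by elim/big_rec2: _ => [//|i y f _ <-]; rewrite loopDE. Qed.

Lemma mono_subproof (x : g) (n : int) :
  (fun k : int => if k == n then x else 0) \in loop_pred.
Proof.
apply/asboolP; apply: (@sub_finite_set _ _ [set n]); last exact: finite_set1.
by move=> k /=; case: (k =P n) => // _; rewrite eqxx.
Qed.

(* x (x) t^n *)
Definition mono (x : g) (n : int) : loop := Loop (mono_subproof x n).

Lemma monoE x n k : mono x n k = if k == n then x else 0.
Proof. by []. Qed.

Definition loop_lie_fun f h (n : int) : g :=
  \sum_(i \in [set: int]) [lie f i, h (n - i)].

Lemma loop_lie_widen f h (s : seq int) n : uniq s ->
  (forall i, f i != 0 -> i \in s) ->
  loop_lie_fun f h n = \sum_(i <- s) [lie f i, h (n - i)].
Proof.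
move=> us fs; rewrite /loop_lie_fun; apply/esym.
rewrite fsbig_seq //; apply: fsbig_widen => //.
move=> i [_ /= nis]; case: (eqVneq (f i) 0) => [->|/fs //]; exact: lie0r.
Qed.

Definition loop_supp f : seq int := fset_set [set n | f n != 0].

Lemma loop_suppP f i : f i != 0 -> i \in loop_supp f.
Proof.
by move=> fi; rewrite /loop_supp in_fset_set ?inE //; apply: loop_finite.
Qed.

Lemma loop_lie_suppE f h n :
  loop_lie_fun f h n = \sum_(i <- loop_supp f) [lie f i, h (n - i)].
Proof. by apply: loop_lie_widen (@loop_suppP f); apply: fset_uniq. Qed.

Lemma loop_lie_subproof f h : loop_lie_fun f h \in loop_pred.
Proof.
apply/asboolP.
pose s := [seq i + j | i <- loop_supp f, j <- loop_supp h].
apply: (@sub_finite_set _ _ [set` s]); last exact: finite_seq.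
move=> n /=; apply: contraNT => ns; rewrite loop_lie_suppE.
rewrite big_seq big1 // => i fi.
case: (eqVneq (h (n - i)) 0) => [->|/loop_suppP hi]; first exact: lier0.
move: ns; rewrite (_ : n = i + (n - i)); last by rewrite addrC subrK.
by rewrite /s allpairs_f.
Qed.

(* The coefficient of t^n in [f, h] is \sum_i [f i, h (n - i)]. *)
Definition loop_lie f h : loop := Loop (loop_lie_subproof f h).

Lemma loop_lieE f h n : loop_lie f h n = loop_lie_fun f h n.
Proof. by []. Qed.

Lemma loop_lie_linearl h : linear (loop_lie^~ h).
Proof.
move=> a f1 f2; apply: loopP => n; rewrite loopDE loopZE !loop_lieE.
pose s := undup (loop_supp f1 ++ loop_supp f2).
have us : uniq s by rewrite undup_uniq.
have s1 i : f1 i != 0 -> i \in s.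
  by move=> /loop_suppP; rewrite mem_undup mem_cat => ->.
have s2 i : f2 i != 0 -> i \in s.
  by move=> /loop_suppP; rewrite mem_undup mem_cat orbC => ->.
have s3 i : (a *: f1 + f2) i != 0 -> i \in s.
  apply: contraR => nis; rewrite loopDE loopZE.
  rewrite (eqP (contraR (s1 i) nis)) (eqP (contraR (s2 i) nis)).
  by rewrite scaler0 addr0.
rewrite (loop_lie_widen _ _ us s3) (loop_lie_widen _ _ us s1).
rewrite (loop_lie_widen _ _ us s2) scaler_sumr -big_split.
by apply: eq_bigr => i _; rewrite loopDE loopZE lieDl lieZl.
Qed.

Lemma loop_lie_linearr f : linear (loop_lie f).
Proof.
move=> a h1 h2; apply: loopP => n; rewrite loopDE loopZE !loop_lieE.
rewrite !loop_lie_suppE scaler_sumr -big_split.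
by apply: eq_bigr => i _; rewrite loopDE loopZE lieDr lieZr.
Qed.

HB.instance Definition _ f :=
  GRing.isLinear.Build K loop loop *:%R (loop_lie f) (loop_lie_linearr f).
Definition loop_rlie h f := loop_lie f h.
HB.instance Definition _ h :=
  GRing.isLinear.Build K loop loop *:%R (loop_rlie h) (loop_lie_linearl h).

Lemma loop_lie0l h : loop_lie 0 h = 0.
Proof. exact: (linear0 (loop_rlie h)). Qed.

Lemma loop_decomp f : f = \sum_(i <- loop_supp f) mono (f i) i.
Proof.
apply: loopP => n; rewrite loop_sumE.
case: (boolP (n \in loop_supp f)) => [nf|nf].
  rewrite (bigD1_seq n) ?fset_uniq //= eqxx big1 ?addr0 // => i.
  by rewrite eq_sym => /negbTE ->.
rewrite big_seq big1 => [|i fi]; first exact/eqP/(contraR (@loop_suppP f n)).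
by rewrite monoE; case: eqP => // ni; rewrite ni fi in nf.
Qed.

Lemma loop_lie_mono x y m n :
  loop_lie (mono x m) (mono y n) = mono [lie x, y] (m + n).
Proof.
apply: loopP => k; rewrite loop_lieE.
rewrite (@loop_lie_widen _ _ [:: m]) // => [|i]; last first.
  by rewrite monoE inE; case: (i == m) => //; rewrite eqxx.
rewrite big_seq1 !monoE eqxx subr_eq (addrC n).
by case: eqP => _ //; exact: lier0.
Qed.

Lemma loop_lie_suml (I : Type) (r : seq I) (F : I -> loop) h :
  loop_lie (\sum_(i <- r) F i) h = \sum_(i <- r) loop_lie (F i) h.
Proof. exact: (linear_sum (loop_rlie h)). Qed.

Lemma loop_lieDl f1 f2 h :
  loop_lie (f1 + f2) h = loop_lie f1 h + loop_lie f2 h.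
Proof. exact: (linearD (loop_rlie h)). Qed.

Lemma loop_lieDr f h1 h2 :
  loop_lie f (h1 + h2) = loop_lie f h1 + loop_lie f h2.
Proof. exact: linearD. Qed.

Lemma loop_lie0r f : loop_lie f 0 = 0.
Proof. exact: linear0. Qed.

(* Multilinear identities need only be checked on the x (x) t^n. *)
Lemma loop_ind (P : loop -> Prop) :
  P 0 -> (forall f h, P f -> P h -> P (f + h)) -> (forall x n, P (mono x n)) ->
  forall f, P f.
Proof. by move=> P0 PD Pm f; rewrite [f]loop_decomp; elim/big_ind: _. Qed.

Lemma loop_lieC f h : loop_lie f h = - loop_lie h f.
Proof.
elim/loop_ind: f => [|f1 f2 e1 e2|x m].
- by rewrite loop_lie0l loop_lie0r oppr0.
- by rewrite loop_lieDl loop_lieDr opprD e1 e2.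
elim/loop_ind: h => [|h1 h2 e1 e2|y n].
- by rewrite loop_lie0l loop_lie0r oppr0.
- by rewrite loop_lieDl loop_lieDr opprD e1 e2.
rewrite !loop_lie_mono lieC addrC; apply: loopP => k.
by rewrite loopNE !monoE; case: eqP; rewrite ?oppr0.
Qed.

Lemma loop_lie_alt f : loop_lie f f = 0.
Proof.
elim/loop_ind: f => [|f1 f2 e1 e2|x m]; first exact: loop_lie0r.
  by rewrite loop_lieDl !loop_lieDr e1 e2 add0r addr0 loop_lieC addNr.
rewrite loop_lie_mono lie_alt; apply: loopP => k.
by rewrite monoE; case: eqP.
Qed.

Lemma loop_lie_jacobi f h k :
  loop_lie f (loop_lie h k) + loop_lie h (loop_lie k f)
    + loop_lie k (loop_lie f h) = 0.
Proof.
have split6 (a b c a' b' c' : loop) : a + b + c = 0 -> a' + b' + c' = 0 ->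
    (a + a') + (b + b') + (c + c') = 0.
  by move=> e e'; rewrite (addrACA a) (addrACA (a + b)) e e' addr0.
elim/loop_ind: f => [|f1 f2 e1 e2|x m].
- by rewrite !(loop_lie0l, loop_lie0r) !addr0.
- by rewrite !(loop_lieDl, loop_lieDr) split6.
elim/loop_ind: h => [|h1 h2 e1 e2|y n].
- by rewrite !(loop_lie0l, loop_lie0r) !addr0.
- by rewrite !(loop_lieDl, loop_lieDr) split6.
elim/loop_ind: k => [|k1 k2 e1 e2|z p].
- by rewrite !(loop_lie0l, loop_lie0r) !addr0.
- by rewrite !(loop_lieDl, loop_lieDr) split6.
rewrite !loop_lie_mono (addrA n p m) (addrC (n + p)) (addrC p (m + n)) -(addrA m).
apply: loopP => i; rewrite !loopDE !monoE loop0E.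
by case: eqP => _; rewrite ?addr0 // lie_jacobi.
Qed.

HB.instance Definition _ := isLieAlgebra.Build K loop
  loop_lie_linearl loop_lie_linearr loop_lie_alt loop_lie_jacobi.

Lemma loop_der_subproof f :
  (fun n : int => (n%:~R : K) *: f n) \in loop_pred.
Proof.
apply/asboolP; apply: sub_finite_set (loop_finite f) => n /=.
by apply: contra_neq => ->; rewrite scaler0.
Qed.

(* The derivation t d/dt. *)
Definition loop_der f : loop := Loop (loop_der_subproof f).

Lemma loop_derE f n : loop_der f n = n%:~R *: f n. Proof. by []. Qed.

Lemma loop_der_linear : linear loop_der.
Proof.
move=> a f h; apply: loopP => n.
by rewrite loop_derE !(loopDE, loopZE) !loop_derE scalerDr !scalerA mulrC.
Qed.

HB.instance Definition _ :=
  GRing.isLinear.Build K loop loop *:%R loop_der loop_der_linear.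

Lemma loop_derD f h : loop_der (f + h) = loop_der f + loop_der h.
Proof. exact: linearD. Qed.

Lemma loop_derZ (a : K) f : loop_der (a *: f) = a *: loop_der f.
Proof. exact: linearZ_LR. Qed.

Lemma loop_derN f : loop_der (- f) = - loop_der f.
Proof. exact: linearN. Qed.

Lemma loop_der0 : loop_der 0 = 0.
Proof. exact: linear0. Qed.

Lemma loop_der_mono x n : loop_der (mono x n) = n%:~R *: mono x n.
Proof.
apply: loopP => k; rewrite loop_derE loopZE !monoE.
by case: eqP => [->|] //; rewrite !scaler0.
Qed.

Lemma lie_mono x y m n :
  [lie mono x m, mono y n] = mono [lie x, y] (m + n).
Proof. exact: loop_lie_mono. Qed.

Lemma loop_der_lie f h :
  loop_der [lie f, h] = [lie loop_der f, h] + [lie f, loop_der h].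
Proof.
elim/loop_ind: f => [|f1 f2 e1 e2|x m].
- by rewrite !(loop_der0, lie0r) addr0.
- by rewrite loop_derD !lieDl loop_derD e1 e2 addrACA.
elim/loop_ind: h => [|h1 h2 e1 e2|y n].
- by rewrite !(loop_der0, lier0) addr0.
- by rewrite loop_derD !lieDr loop_derD e1 e2 addrACA.
by rewrite !loop_der_mono lieZl lieZr -scalerDl lie_mono loop_der_mono -intrD.
Qed.

(* L^e(g) : the pair (f, a) stands for f + a d. *)
Definition loope := (loop * K^o)%type.

HB.instance Definition _ := GRing.Lmodule.on loope.

Definition loope_lie (u v : loope) : loope :=
  ([lie u.1, v.1] + u.2 *: loop_der v.1 - v.2 *: loop_der u.1, 0).

Lemma loope_lie_linearr u : linear (loope_lie u).
Proof.
move=> a v w; congr pair; last by rewrite /= scaler0 addr0.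
transitivity (a *: ([lie u.1, v.1] + u.2 *: loop_der v.1 - v.2 *: loop_der u.1)
  + ([lie u.1, w.1] + u.2 *: loop_der w.1 - w.2 *: loop_der u.1)); last by [].
rewrite [LHS]/= lieDr lieZr loop_derD loop_derZ.
rewrite !scalerDr scalerDl scalerN !scalerA (mulrC u.2) opprD.
by rewrite (addrACA (a *: _) [lie u.1, w.1]) [LHS]addrACA.
Qed.

Lemma loope_lie_alt u : loope_lie u u = 0.
Proof. by rewrite /loope_lie lie_alt add0r subrr. Qed.

Lemma loope_lieC u v : loope_lie u v = - loope_lie v u.
Proof.
congr pair; last by rewrite /= oppr0.
by rewrite [LHS]/= lieC !opprD opprK addrAC.
Qed.

Lemma loope_lie_linearl v : linear (loope_lie^~ v).
Proof.
move=> a u w; rewrite (loope_lieC _ v) loope_lie_linearr opprD -scalerN.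
by rewrite -!(loope_lieC _ v).
Qed.

Lemma loope_lie_jacobi u v w :
  loope_lie u (loope_lie v w) + loope_lie v (loope_lie w u)
    + loope_lie w (loope_lie u v) = 0.
Proof.
congr pair; last by rewrite /= !addr0.
case: u v w => [u a] [v b] [w c] /=.
rewrite !(loop_derD, loop_der_lie, lieDr, lieZr, lierN) !scale0r !subr0
  !(loop_derN, loop_derZ) !scalerDr !scalerN !scalerA.
rewrite (lieC (loop_der v) w) (lieC (loop_der u) v) (lieC (loop_der w) u).
rewrite !scalerN (mulrC b a) (mulrC c a) (mulrC c b) !addrA.
rewrite [LHS](ACl ((1*8*15)*(2*11)*(3*19)*(4*16)*(5*10)*(6*14)*(7*20)
  *(9*18)*(12*17)*(13*21))) /=.
by rewrite !(subrr, addNr, addr0) lie_jacobi.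
Qed.

HB.instance Definition _ := isLieAlgebra.Build K loope
  loope_lie_linearl loope_lie_linearr loope_lie_alt loope_lie_jacobi.

Lemma lie_d_mono x n :
  [lie ((0, 1) : loope), ((mono x n, 0) : loope)] = (n%:~R *: mono x n, 0).
Proof.
by congr pair; rewrite /= lie0r add0r scale1r scale0r subr0 loop_der_mono.
Qed.

End Loop.

Section Sums.
Variables (K : pzRingType) (V : lmodType K).

Definition zspan (S : set V) : set V :=
  [set v | exists (n : nat) (c : 'I_n -> int) (s : 'I_n -> V),
     (forall i, S (s i)) /\ v = \sum_i s i *~ c i].

Definition fin_dim (U : set V) :=
  exists (n : nat) (b : 'I_n -> V), (forall i, U (b i)) /\
    forall v, U v -> exists c : 'I_n -> K, v = \sum_i c i *: b i.

(* A choice of one element in each F j, j in D, almost all of them zero. *)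
Definition fin_family (J : choiceType) (D : set J) (F : J -> set V)
    (f : J -> V) :=
  finite_set [set j | D j /\ f j != 0] /\ forall j, D j -> F j (f j).

Definition set_sum (J : choiceType) (D : set J) (F : J -> set V) : set V :=
  [set v | exists2 f, fin_family D F f & v = \sum_(j \in D) f j].

(* U is the internal direct sum of the subspaces F j, j in D. *)
Definition direct_sum (J : choiceType) (D : set J) (F : J -> set V)
    (U : set V) :=
  set_sum D F = U /\
  forall f, fin_family D F f -> \sum_(j \in D) f j = 0 ->
    forall j, D j -> f j = 0.

Definition direct_sum2 (A B U : set V) :=
  [set a + b | a in A & b in B] = U /\ A `&` B = [set 0].

End Sums.

Section Modules.
Variables (K : fieldType) (L : lieAlgType K) (V : lmodType K).

Record lie_action := LieAction {
  act :> L -> V -> V;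
  act_linearl : forall v, linear (act^~ v);
  act_linearr : forall x, linear (act x);
  act_lie : forall x y v, act [lie x, y] v = act x (act y v) - act y (act x v)
}.

Variable rho : lie_action.

Definition submodule (U : set V) :=
  [/\ U 0, forall a u v, U u -> U v -> U (a *: u + v)
    & forall x u, U u -> U (rho x u)].

Definition indecomposable (U : set V) :=
  [/\ submodule U, U <> [set 0]
    & forall A B, submodule A -> submodule B -> direct_sum2 A B U ->
        A = [set 0] \/ B = [set 0]].

Definition annihilated (A : set L) : set V :=
  [set v | forall x, A x -> rho x v = 0].

End Modules.

Section FiniteDimensional.
Variables (K : fieldType) (g : finLieAlgType K).

Definition simple_lie :=
  (exists x y : g, [lie x, y] <> 0) /\
  forall J : {vspace g}, (forall x y, y \in J -> [lie x, y] \in J) ->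
    J = 0%VS \/ J = fullv.

Definition abelian_sub (k : {vspace g}) :=
  {in k &, forall x y, [lie x, y] = 0}.

Definition ad_diagonalizable (x : g) :=
  exists2 b : seq g, basis_of fullv b &
    forall v, v \in b -> exists c : K, [lie x, v] = c *: v.

(* Cartan subalgebras of a complex semisimple Lie algebra: the maximal abelian
   subalgebras all of whose elements are ad-semisimple. *)
Definition cartan (h : {vspace g}) :=
  [/\ abelian_sub h,
      forall k : {vspace g}, abelian_sub k -> (h <= k)%VS -> k = h
    & forall x, x \in h -> ad_diagonalizable x].

End FiniteDimensional.

Section Roots.
Variables (C : numClosedFieldType) (g : finLieAlgType C) (h : {vspace g}).

Definition cdual := 'Hom(subvs_of h, C^o).

Definition root_space (b : cdual) : set g :=
  [set x | forall z : subvs_of h, [lie vsval z, x] = (b z : C) *: x].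

Definition roots : set cdual :=
  [set b | b <> 0 /\ exists2 x, root_space b x & x <> 0].

Definition lie_prod (A B : set g) : set g :=
  [set x | exists (n : nat) (a b : 'I_n -> g),
     [/\ forall i, A (a i), forall i, B (b i) & x = \sum_i [lie a i, b i]]].

(* The element z of [g_b, g_-b], a line in h, such that b z = 2. *)
Definition coroot (b : cdual) : subvs_of h :=
  xget 0 [set z | lie_prod (root_space b) (root_space (- b)) (vsval z)
                  /\ b z = 2%:R].

(* The reflection attached to b, acting on h. *)
Definition refl (b : cdual) (z : subvs_of h) : subvs_of h :=
  z - (b z : C) *: coroot b.

(* Reflections being involutions, the monoid they generate is a group. *)
Inductive weyl : (subvs_of h -> subvs_of h) -> Prop :=
| weyl_id : weyl id
| weyl_refl b w : roots b -> weyl w -> weyl (refl b \o w).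

Definition weyl_orbit (z : subvs_of h) : set (subvs_of h) :=
  [set y | exists2 w, weyl w & y = w z].

Variables (I : finType) (alpha : I -> cdual).

(* The cone \sum_i N alpha_i. *)
Definition Qplus : set cdual :=
  [set b | exists c : I -> nat, b = \sum_i alpha i *+ c i].

Definition simple_roots :=
  [/\ forall i, roots (alpha i), free [seq alpha i | i <- enum I]
    & forall b, roots b -> Qplus b \/ Qplus (- b)].

Definition pos_roots : set cdual := roots `&` Qplus.

Definition highest_root (theta : cdual) :=
  roots theta /\ forall b, roots b -> Qplus (theta - b).

Definition wt : set cdual :=
  [set mu | forall i, exists n : int, mu (coroot (alpha i)) = n%:~R].

Definition dom_wt : set cdual :=
  [set mu | forall i, exists n : nat, mu (coroot (alpha i)) = n%:R].

Definition nplus : set g := set_sum pos_roots root_space.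

Definition Lnplus : set (loope g) :=
  [set u : loope g | (forall n, nplus (u.1 n)) /\ u.2 = 0].

Definition Lg : set (loope g) := [set u : loope g | u.2 = 0].

(* The pair (mu, s) is the element mu + s delta of h_e^* = h^* + C delta. *)
Definition ewt := (cdual * C)%type.

Definition Pe : set ewt := [set l | wt l.1 /\ exists n : int, l.2 = n%:~R].

Definition Pe_dom : set ewt := [set l | dom_wt l.1 /\ exists n : int, l.2 = n%:~R].

Definition Zdelta : set ewt := [set l | l.1 = 0 /\ exists n : int, l.2 = n%:~R].

Variable theta : cdual.

Definition r_values (mu : cdual) : set C :=
  [set c | 0 < c /\
     exists2 z, zspan (weyl_orbit (coroot theta)) z & c = mu z].

(* The minimum of r_values mu, which consists of positive integers and is
   nonempty when mu is a nonzero integral weight. *)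
Definition r_wt (mu : cdual) : C :=
  xget 0 [set c | r_values mu c /\ forall c', r_values mu c' -> c <= c'].

Variables (V : lmodType C) (rho : lie_action (loope g) V).

Definition weight_space (l : ewt) : set V :=
  [set v | forall (z : subvs_of h) (a : C),
     rho (mono (vsval z) 0, a) v = (l.1 z + l.2 * a) *: v].

(* U^+ for a submodule U. *)
Definition plus_part (U : set V) : set V :=
  set_sum [set l | [/\ Pe_dom l, ~ Zdelta l & 0 <= l.2 < r_wt l.1]]
    (fun l => U `&` weight_space l `&` annihilated rho Lnplus).

Variables xp xm : cdual -> g.

(* xp b and xm b are the root vectors x_b^+ and x_b^-. *)
Definition root_vectors := forall b, pos_roots b ->
  [/\ root_space b (xp b), xp b <> 0, root_space (- b) (xm b) & xm b <> 0].

Definition locally_nilpotent (f : V -> V) := forall v, exists n, iter n f v = 0.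

Definition integrable :=
  direct_sum setT weight_space setT /\
  forall b (s : int), pos_roots b ->
    locally_nilpotent (rho (mono (xp b) s, 0)) /\
    locally_nilpotent (rho (mono (xm b) s, 0)).

Definition Ifin :=
  [/\ integrable,
      forall l, weight_space l <> [set 0] -> Pe l
    & forall l, fin_dim (weight_space l)].

End Roots.

(* Main.v *)
Require Import Defs.
From HB Require Import structures.
From mathcomp Require Import all_boot all_order all_algebra.
From mathcomp Require Import finmap complex ring.
From mathcomp Require Import all_classical reals.
Set Implicit Arguments.
Unset Strict Implicit.
Unset Printing Implicit Defensive.
Import Order.TTheory GRing.Theory Num.Theory.
Local Open Scope classical_set_scope.
Local Open Scope ring_scope.

(** The idea is to bound the number of nontrivial summands by weights.

    In g, a basis of weight vectors (weight_basis) and one lemma on lowest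
    weight vectors (lowest_weight) give what is needed of root theory: the
    Killing form is nondegenerate, and nonzero vectors of opposite root span, up
    to scaling, an sl2-triple (sl2_triple). The Killing form also yields a norm
    on weights that decreases when a root b is subtracted from a weight mu with
    mu (H_b) >= 2 (form_descent).

    Let M be a submodule of V that is not killed by L(g). It has a weight mu + s
    delta with mu nonzero (nontrivial_weight), and a root b with mu (H_b) > 0,
    up to exchanging b and -b. Since x_b t^s, x_(-b) t^(-s) and H_b form an
    sl2-triple acting integrably, x_(-b) t^(-s) does not kill a vector of that
    weight, and maps it to degree 0. Minimizing the norm among the weights of M
    of degree 0 gives a weight mu of M with |mu (H_b)| <= 1 for all b
    (nontrivial_small_weight). There are finitely many such mu, so every
    nontrivial submodule meets one fixed finite dimensional subspace W of V.

    Let K be the invariants of L(g) in V. Then V = U1 + U2, a direct sum of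
    submodules, where U1 is a complement of K `&` L(g)V in K and U2 contains
    L(g)V (invariant_splitting). The invariants of U2 lie in L(g) U2; this
    property is inherited by direct summands and excludes nonzero trivial ones.
    Hence every nonzero summand of U2 meets W, and splitting U2 repeatedly stops
    after finitely many steps (essential_decomposition). The module U1 is a
    direct sum of lines spanned by weight vectors, and each line is a submodule
    (invariants_decomposition). Finally U2 and V have the same weight spaces for
    weights that do not vanish on h (weight_vector_summand), so U2^+ = V^+. *)

(** * Subspaces and joint eigenvectors *)

(** Linear subspaces of an arbitrary module, as classical sets. *)
Definition subspace (K : fieldType) (V : lmodType K) (U : set V) :=
  U 0 /\ forall a u v, U u -> U v -> U (a *: u + v).

Section Subspace.
Variables (K : fieldType) (V : lmodType K).
Implicit Types U A B : set V.

Lemma subspaceD U u v : subspace U -> U u -> U v -> U (u + v).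
Proof. by move=> [_ sU] Uu Uv; rewrite -[u]scale1r; apply: sU. Qed.

Lemma subspaceZ U a u : subspace U -> U u -> U (a *: u).
Proof. by move=> [U0 sU] Uu; rewrite -[_ *: _]addr0; apply: sU. Qed.

Lemma subspaceN U u : subspace U -> U u -> U (- u).
Proof. by move=> sU Uu; rewrite -scaleN1r; apply: subspaceZ. Qed.

Lemma subspaceB U u v : subspace U -> U u -> U v -> U (u - v).
Proof. by move=> sU Uu Uv; apply: subspaceD => //; apply: subspaceN. Qed.

Lemma subspace_sum U (I : eqType) (r : seq I) (F : I -> V) :
  subspace U -> (forall i, i \in r -> U (F i)) -> U (\sum_(i <- r) F i).
Proof.
move=> sU UF; rewrite big_seq; elim/big_ind: _ => //; first exact: sU.1.
by move=> u v; apply: subspaceD.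
Qed.

Lemma subspaceDr U u v : subspace U -> U u -> U (u + v) -> U v.
Proof.
by move=> sU Uu Uuv; rewrite -(addKr u v) addrC; apply: subspaceB.
Qed.

Lemma subspace0 : subspace [set (0 : V)].
Proof. by split=> //= a u v -> ->; rewrite scaler0 addr0. Qed.

Lemma subspaceI A B : subspace A -> subspace B -> subspace (A `&` B).
Proof.
move=> [A0 sA] [B0 sB]; split=> // a u v [Au Bu] [Av Bv].
by split; [apply: sA | apply: sB].
Qed.

(** The sum of two subspaces. *)
Definition sum_set A B : set V := [set a + b | a in A & b in B].

Lemma sum_setE A B v : sum_set A B v <-> exists a b, [/\ A a, B b & v = a + b].
Proof.
split=> [[a Aa [b Bb <-]]|[a [b [Aa Bb ->]]]]; first by exists a, b.
by exists a => //; exists b.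
Qed.

Lemma subspace_sum_set A B : subspace A -> subspace B -> subspace (sum_set A B).
Proof.
move=> sA sB; split.
  by apply/sum_setE; exists 0, 0; rewrite addr0; split=> //;
    [apply: sA.1|apply: sB.1].
move=> a u v /sum_setE[u1 [u2 [? ? ->]]] /sum_setE[v1 [v2 [? ? ->]]].
apply/sum_setE; exists (a *: u1 + v1), (a *: u2 + v2).
by rewrite scalerDr addrACA; split=> //; [apply: sA.2|apply: sB.2].
Qed.

Lemma direct_sum2E A B U : subspace A -> subspace B ->
  direct_sum2 A B U <->
  sum_set A B = U /\ forall a, A a -> B a -> a = 0.
Proof.
move=> [A0 _] [B0 _]; split=> [[e i]|[e i]]; split=> //.
  by move=> a Aa Ba; have : (A `&` B) a by []; rewrite i.
by apply/seteqP; split=> [a [Aa Ba]|a ->]; [apply: i|].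
Qed.

(** The components of a vector in a direct sum are unique. *)
Lemma direct_uniq A B a a' b b' : subspace A -> subspace B ->
  (forall a, A a -> B a -> a = 0) -> A a -> A a' -> B b -> B b' ->
  a + b = a' + b' -> a = a' /\ b = b'.
Proof.
move=> sA sB d Aa Aa' Bb Bb' e.
have e1 : a - a' = b' - b.
  by apply/eqP; rewrite subr_eq addrAC eq_sym subr_eq [b' + _]addrC eq_sym e.
have z : a - a' = 0 by apply: d; [|rewrite e1]; apply: subspaceB.
split; first exact/subr0_eq.
by apply/esym/subr0_eq; rewrite -e1.
Qed.

End Subspace.

(* The usual rules for a plain function that satisfies the predicate linear. *)
Section LinearMaps.
Variables (K : fieldType) (U V : lmodType K) (f : U -> V).
Hypothesis lf : linear f.

Let g : {linear U -> V} :=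
  HB.pack f (GRing.isLinear.Build K U V *:%R f lf).

Lemma lin0 : f 0 = 0. Proof. exact: (linear0 g). Qed.
Lemma linD u v : f (u + v) = f u + f v. Proof. exact: (linearD g). Qed.
Lemma linB u v : f (u - v) = f u - f v. Proof. exact: (linearB g). Qed.
Lemma linZ a u : f (a *: u) = a *: f u. Proof. exact: (linearZ_LR g). Qed.
Lemma linMn u n : f (u *+ n) = f u *+ n. Proof. exact: (raddfMn g). Qed.
Lemma lin_sum (I : Type) (r : seq I) (P : pred I) (F : I -> U) :
  f (\sum_(i <- r | P i) F i) = \sum_(i <- r | P i) f (F i).
Proof. exact: (linear_sum g). Qed.

End LinearMaps.

(** Let op be a family of operators, and let the f t be joint eigenvectors whose
    systems of eigenvalues ev t are pairwise distinct.  A subspace stable under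
    op that contains the sum of the f t contains each of them. *)
Lemma eigen_components (K : fieldType) (V : lmodType K) (X : Type)
    (T : eqType) (op : X -> V -> V) (ev : T -> X -> K) (U : set V) :
  (forall x, linear (op x)) ->
  (forall t t', t != t' -> exists x, ev t x != ev t' x) ->
  subspace U -> (forall x u, U u -> U (op x u)) ->
  forall (s : seq T) (f : T -> V), uniq s ->
    (forall t, t \in s -> forall x, op x (f t) = ev t x *: f t) ->
    U (\sum_(t <- s) f t) -> forall t, t \in s -> U (f t).
Proof.
move=> lop sep sU stU; elim=> [//|t0 s IHs] f /= /andP[t0s us] ef Us.
have Uin t : t \in s -> U (f t).
  move=> ts; have tt0 : t != t0 by apply: contraNneq t0s => <-.
  have [x nx] := sep _ _ tt0.
  (* op x - ev t0 x kills f t0 and rescales the other terms, f t by a nonzero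
     scalar, so that the induction hypothesis applies to the g t'. *)
  pose g t' := (ev t' x - ev t0 x) *: f t'.
  have Ug : U (g t).
    apply: IHs ts => // [t' t's y|].
      by rewrite linZ // ef ?inE ?t's ?orbT // !scalerA mulrC.
    suff -> : \sum_(t' <- s) g t' =
      op x (\sum_(t' <- t0 :: s) f t') - ev t0 x *: \sum_(t' <- t0 :: s) f t'.
      by apply: subspaceB => //; [apply: stU|apply: subspaceZ].
    rewrite lin_sum // scaler_sumr -sumrB big_cons ef ?mem_head //.
    rewrite subrr add0r; apply: eq_big_seq => t' t's.
    by rewrite ef ?inE ?t's ?orbT // -scalerBl.
  move: Ug => /(subspaceZ (ev t x - ev t0 x)^-1 sU).
  by rewrite scalerA mulVf ?scale1r ?subr_eq0.
move=> t; rewrite inE => /orP[/eqP->|]; last exact: Uin.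
move: Us; rewrite big_cons addrC; apply: subspaceDr => //.
by apply: subspace_sum.
Qed.

(** * Lowest weight vectors *)

Section LowestWeight.
Variables (C : numFieldType) (V : lmodType C) (E F H : V -> V) (a : C).
Hypotheses (lE : linear E) (lF : linear F).
Hypothesis EF : forall v, E (F v) - F (E v) = H v.
Hypothesis HE : forall v, H (E v) - E (H v) = a *: E v.

(** In a module where [E, F] = H and [H, E] = a E, a vector killed by F, of
    H-weight c, on which E acts nilpotently, has c = - a m / 2 for some
    natural m: at the last nonzero power of E, the formula for F E^(m+1) w
    gives 2 c + a m = 0.  The case a = 0 is allowed and gives c = 0. *)
Lemma lowest_weight w c : w != 0 -> F w = 0 -> H w = c *: w ->
  (exists n, iter n E w = 0) -> exists m : nat, c *+ 2 = - (a *+ m).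
Proof.
move=> w0 Fw Hw nilE.
have HEk k : H (iter k E w) = (c + a *+ k) *: iter k E w.
  elim: k => [|k IHk]; first by rewrite mulr0n addr0.
  rewrite iterS; move/eqP: (HE (iter k E w)); rewrite subr_eq => /eqP->.
  by rewrite IHk (linZ lE) -scalerDl mulrS addrCA.
have FEk k : F (iter k.+1 E w) *+ 2 =
    - ((c *+ 2 + a *+ k) *+ k.+1) *: iter k E w.
  elim: k => [|k IHk].
    have := EF w; rewrite Fw (lin0 lE) sub0r Hw => /(congr1 -%R).
    rewrite opprK /= => ->.
    by rewrite mulr1n mulr0n addr0 -scaleNr scalerMnl mulNrn.
  rewrite [iter k.+2 E w]iterS.
  have -> : F (E (iter k.+1 E w)) = E (F (iter k.+1 E w)) - H (iter k.+1 E w).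
    by rewrite -EF opprB addrC subrK.
  rewrite mulrnBl -(linMn lE) IHk (linZ lE) HEk scalerMnl -scalerBl.
  by congr (_ *: _); ring.
have Emin : exists n, iter n E w == 0 by case: nilE => n /eqP; exists n.
case: (ex_minnP Emin) => -[|m] /eqP Em mmin; first by move: w0; rewrite [w]Em eqxx.
exists m; have := FEk m; rewrite Em (lin0 lF) mul0rn => /esym/eqP.
rewrite scaler_eq0 oppr_eq0 mulrn_eq0 /= => /orP[|/mmin].
  by rewrite addr_eq0 => /eqP.
by rewrite ltnn.
Qed.

End LowestWeight.

(** * A basis of weight vectors of the Lie algebra *)

(** A nonempty bounded set of natural numbers has a maximum. *)
Lemma ex_max (P : nat -> Prop) (b : nat) : (exists n, P n) ->
  (forall n, P n -> (n <= b)%N) ->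
  exists2 n, P n & forall m, P m -> (m <= n)%N.
Proof.
move=> [n Pn] bP.
have eP : exists n, `[< P n >] by exists n; apply/asboolP.
have bP' n' : `[< P n' >] -> (n' <= b)%N by move/asboolP/bP.
case: (ex_maxnP eP bP') => k /asboolP Pk kmax.
by exists k => // m Pm; apply/kmax/asboolP.
Qed.

(** A classical subspace of a finite dimensional space is a {vspace _}. *)
Lemma subspace_vspace (K : fieldType) (vT : vectType K) (P : set vT) :
  subspace P -> exists U : {vspace vT}, forall v, v \in U <-> P v.
Proof.
move=> sP.
pose good n := exists2 U : {vspace vT}, (forall v, v \in U -> P v) & \dim U = n.
have [|n [U _ <-]|n [U UP dU] nmax] := @ex_max good (\dim (@fullv _ vT)).
- by exists 0%N, 0%VS; rewrite ?dimv0 // => v; rewrite memv0 => /eqP->; apply: sP.1.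
- exact/dimvS/subvf.
exists U => v; split; first exact: UP.
move=> Pv; apply: contraPT (leqnn n) => vU; apply/negP; rewrite -ltnNge.
apply: leq_trans (_ : (\dim (U + <[v]>) <= n)%N); last first.
  apply: nmax; exists (U + <[v]>)%VS => // w /memv_addP[u uU [_ /vlineP[c ->] ->]].
  by apply: subspaceD => //; [apply: UP|apply: subspaceZ].
rewrite -dU ltnNge; apply: contra vU => dle.
by rewrite (eqP (_ : U == U + <[v]>)%VS) ?memv_addr ?memv_line //
  1?eqEdim ?addvSl ?dle // (subvP (addvSr U <[v]>)) // memv_line.
Qed.

Lemma sum_group (V : nmodType) (T : eqType) (I : finType) (c : I -> T)
    (F : I -> V) (s : seq T) : uniq s -> (forall i, c i \in s) ->
  \sum_i F i = \sum_(t <- s) \sum_(i | c i == t) F i.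
Proof.
move=> us cs; under [RHS]eq_bigr do rewrite big_mkcond.
rewrite exchange_big; apply: eq_bigr => i _ /=.
rewrite (bigD1_seq (c i)) //= eqxx big1 ?addr0 // => t.
by rewrite eq_sym => /negbTE->.
Qed.

Lemma simple_ideal (K : fieldType) (g : finLieAlgType K) (J : set g) :
  simple_lie g -> subspace J -> (forall x y, J y -> J [lie x, y]) ->
  (forall y, J y -> y = 0) \/ (forall y, J y).
Proof.
move=> [_ simg] sJ idJ; have [U UJ] := subspace_vspace sJ.
case: (simg U) => [x y /UJ Jy|U0|Uf]; first exact/UJ/idJ.
  by left=> y /UJ; rewrite U0 memv0 => /eqP.
by right=> y; apply/UJ; rewrite Uf memvf.
Qed.

Section WeightBasis.
Variables (C : numClosedFieldType) (g : finLieAlgType C) (h : {vspace g}).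
Hypothesis hh : cartan h.

(** Commuting diagonalizable operators: the joint eigenvectors of finitely many
    elements of h span g. *)
Lemma joint_eigen (zs : seq g) (U : set g) :
  {subset zs <= h} -> subspace U ->
  (forall w, (forall z, z \in zs -> exists c : C, [lie z, w] = c *: w) -> U w) ->
  forall v, U v.
Proof.
move=> zsh sU; have [abh _ diagh] := hh.
elim: zs zsh => [|z zs IHzs] zsh UE; first by move=> v; apply: UE.
apply: IHzs => [y yzs|w wE]; first by apply: zsh; rewrite inE yzs orbT.
have [b bb be] := diagh z (zsh _ (mem_head _ _)).
pose bt := in_tuple b.
have /choice[c cE] : forall i, exists c : C, [lie z, bt`_i] = c *: bt`_i.
  move=> i; case: (ltnP i (size b)) => [ib|ib]; first exact/be/mem_nth.
  by exists 0; rewrite nth_default // lier0 scale0r.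
have /choice[d dE] : forall y : g, exists c : C, y \in zs -> [lie y, w] = c *: w.
  move=> y; case yzs: (y \in zs); last by exists 0.
  by have [c0 ?] := wE _ yzs; exists c0.
pose f (t : C) := \sum_(i < size b | c i == t) coord bt i w *: bt`_i.
pose s := undup [seq c i | i : 'I_(size b)].
have sumf : \sum_(t <- s) f t = w.
  rewrite -sum_group ?undup_uniq // => [|i]; last first.
    by rewrite mem_undup; apply/mapP; exists i; rewrite ?mem_enum.
  rewrite -(coord_span (X := bt)) // (span_basis (X := bt) (U := fullv)) ?memvf //.
pose W : set g := [set x | forall y, y \in zs -> [lie y, x] = d y *: x].
have sW : subspace W.
  split=> [y _|a u v Wu Wv y yzs]; first by rewrite lier0 scaler0.
  by rewrite lieDr lieZr Wu // Wv // scalerDr !scalerA mulrC.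
have fz t : [lie z, f t] = t *: f t.
  rewrite (linear_sum (lie z)) scaler_sumr; apply: eq_bigr => i /eqP <- /=.
  by rewrite lieZr cE !scalerA mulrC.
rewrite -sumf; apply: subspace_sum => // t ts; apply: UE => y.
rewrite inE => /orP[/eqP->|yzs]; first by exists t.
exists (d y); move: y yzs; rewrite -/(W (f t)).
apply: (@eigen_components C g unit C (fun _ => lie z) (fun t _ => t) W _ _ _ _ s)
  => //.
- by move=> _; apply: lie_linearr.
- move=> _ x Wx y yzs.
  have zy : [lie z, y] = 0.
    by apply: abh; apply: zsh; rewrite inE ?eqxx ?yzs ?orbT.
  have := lie_jacobi z y x.
  rewrite (lieC x z) lierN zy lier0 addr0 Wx // lieZr => /eqP.
  by rewrite subr_eq0 => /eqP.
- exact: undup_uniq.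
by rewrite sumf => y; apply: dE.
Qed.

(** A joint eigenvector of a basis of h lies in a weight space; the weight 0 is
    allowed here. *)
Lemma weight_of_eigen (w : g) : 
  (forall z, z \in (vbasis h : seq g) -> exists c : C, [lie z, w] = c *: w) ->
  exists b : cdual h, root_space b w.
Proof.
move=> wE; case: (eqVneq w 0) => [->|w0].
  by exists 0 => z; rewrite lier0 scaler0.
have wEh z : z \in h -> exists c : C, [lie z, w] = c *: w.
  move=> /coord_vbasis ->; elim/big_ind: _ => [|x y [cx ex] [cy ey]|i _].
  - by exists 0; rewrite lie0r scale0r.
  - by exists (cx + cy); rewrite lieDl ex ey scalerDl.
  have [|c ec] := wE (vbasis h)`_i.
    by apply: mem_nth; rewrite size_tuple.
  by exists (coord (vbasis h) i z * c); rewrite lieZl ec scalerA.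
(* The eigenvalue is read off on a nonzero coordinate of w, which makes it
   visibly linear in z. *)
have [i wi] : exists i, coord (vbasis fullv) i w != 0.
  apply/existsP; apply: contraNT w0; rewrite negb_exists => /forallP e0.
  rewrite (coord_vbasis (memvf w)) big1 // => i _.
  by move: (e0 i); rewrite negbK => /eqP->; rewrite scale0r.
pose b0 (z : subvs_of h) : C^o :=
  coord (vbasis fullv) i [lie vsval z, w] / coord (vbasis fullv) i w.
have lb : linear b0.
  move=> a u v; rewrite /b0 !linearP /= lieDl lieZl !linearP /=.
  by rewrite mulrDl -mulrA.
pose bm := GRing.isLinear.Build C (subvs_of h) C^o *:%R b0 lb.
pose bl : {linear subvs_of h -> C^o} := HB.pack b0 bm.
exists (linfun bl) => z; rewrite lfunE /=.
have [c ec] := wEh _ (subvsP z).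
by rewrite /b0 ec linearZ /= mulfK.
Qed.

(** The root space decomposition, in the form of a basis e of g consisting of
    weight vectors; eps i is the weight of the i-th one, possibly 0. *)
Lemma weight_basis : exists n (e : n.-tuple g) (eps : 'I_n -> cdual h),
  basis_of fullv e /\ forall i, root_space (eps i) e`_i.
Proof.
pose good n := exists X : seq g, [/\ free X, size X = n &
  forall w, w \in X -> exists b : cdual h, root_space b w].
have [|n [X [fX <- _]]|n [X [fX sX wX]] nmax] := @ex_max good (\dim (@fullv _ g)).
- by exists 0%N, [::]; split=> //; apply: nil_free.
- by rewrite -(eqP fX); apply/dimvS/subvf.
have memX w : (exists b : cdual h, root_space b w) -> w \in <<X>>%VS.
  move=> wb; apply: contraPT (leqnn n) => wnX; apply/negP; rewrite -ltnNge.
  apply: nmax; exists (w :: X); split; rewrite /= ?sX //.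
    by rewrite free_cons wnX.
  by move=> x; rewrite inE => /orP[/eqP->|/wX].
have Xfull v : v \in <<X>>%VS.
  move: v; pose U : set g := [set v | v \in <<X>>%VS].
  apply: (@joint_eigen (vbasis h) U) => [z /vbasis_mem //||w].
    by split=> [|a u v]; [apply: mem0v|move=> Uu Uv; apply: rpredD => //; apply:
      rpredZ].
  by move/weight_of_eigen/memX.
have /choice[eps epsP] : forall i : 'I_(size X),
    exists b : cdual h, root_space b X`_i.
  by move=> i; apply/wX/mem_nth.
exists (size X), (in_tuple X), eps; split=> //.
rewrite basisEfree fX subvf /=.
by rewrite -(eqP fX); apply/dimvS/subvP=> v _; apply: Xfull.
Qed.

End WeightBasis.

(** * Root spaces and root strings *)

Lemma lie_lie (K : fieldType) (L : lieAlgType K) (x y v : L) :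
  [lie x, [lie y, v]] - [lie y, [lie x, v]] = [lie [lie x, y], v].
Proof.
have := lie_jacobi x y v; rewrite (lieC v x) lierN (lieC v [lie x, y]).
by move/eqP; rewrite subr_eq0 => /eqP.
Qed.

Section RootSpaces.
Variables (C : numClosedFieldType) (g : finLieAlgType C) (h : {vspace g}).
Hypotheses (hg : simple_lie g) (hh : cartan h).
Variables (n : nat) (e : n.-tuple g) (eps : 'I_n -> cdual h).
Hypotheses (ebasis : basis_of fullv e).
Hypothesis (eweight : forall i, root_space (eps i) e`_i).
Implicit Types (b c : cdual h) (x y v : g) (z : subvs_of h).

Lemma root_space_subspace b : subspace (root_space b).
Proof.
split=> [z|a u v bu bv z]; first by rewrite lier0 scaler0.
by rewrite lieDr lieZr bu bv scalerDr !scalerA mulrC.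
Qed.

Lemma root_space_lie b c x y :
  root_space b x -> root_space c y -> root_space (b + c) [lie x, y].
Proof.
move=> bx cy z; rewrite add_lfunE scalerDl -[RHS]addrC.
have /eqP := lie_lie (vsval z) x y; rewrite subr_eq => /eqP->.
by rewrite bx cy lieZl lieZr addrC.
Qed.

Lemma eE v : v = \sum_i coord e i v *: e`_i.
Proof. by apply: coord_span; rewrite (span_basis ebasis) memvf. Qed.

Lemma coord_lie_h z v i : coord e i [lie vsval z, v] = eps i z * coord e i v.
Proof.
rewrite {1}[v]eE (linear_sum (lie (vsval z))) linear_sum (bigD1 i) //= lieZr.
rewrite eweight !linearZ /= coord_free ?(basis_free ebasis) // eqxx mulr1 mulrC.
rewrite big1 ?addr0 // => j ji; rewrite lieZr eweight !linearZ /=.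
by rewrite coord_free ?(basis_free ebasis) // (negbTE ji) !mulr0.
Qed.

Lemma cdual_neq b c : b != c -> exists z, b z != c z.
Proof.
move=> bc; have [//|nz] := pselect (exists z, b z != c z).
case/eqP: bc; apply/lfunP => z; apply/eqP; apply: contraPT isT => bz.
by case: nz; exists z.
Qed.

Lemma cdualMn b z k : (b *+ k) z = b z *+ k.
Proof. by elim: k => [|k IH]; rewrite ?lfunE // !mulrS add_lfunE IH. Qed.

Lemma root_space_coord b x i : root_space b x -> eps i != b -> coord e i x = 0.
Proof.
move=> bx /cdual_neq[z zN]; have := coord_lie_h z x i.
rewrite bx linearZ /= => /eqP; rewrite -subr_eq0 -mulrBl mulf_eq0 subr_eq0.
by rewrite eq_sym (negbTE zN) => /eqP.
Qed.

Lemma root_space_eps b x : root_space b x -> x != 0 -> exists i, eps i = b.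
Proof.
move=> bx x0; have [//|nE] := pselect (exists i, eps i = b).
case/eqP: x0; rewrite [x]eE big1 // => i _.
rewrite (root_space_coord bx) ?scale0r //.
by apply: contra_notN nE => /eqP; exists i.
Qed.

(** The weight space of 0 is h, because h is maximal abelian. *)
Lemma root_space0 x : root_space (0 : cdual h) x <-> x \in h.
Proof.
have [abh maxh _] := hh; split=> [x0|xh z]; last first.
  by rewrite lfunE /= scale0r abh // subvsP.
have xz y : y \in h -> [lie y, x] = 0.
  by move=> yh; have := x0 (Subvs yh); rewrite lfunE /= scale0r.
have ab : abelian_sub (h + <[x]>)%VS.
  move=> u v /memv_addP[u1 u1h [u2 /vlineP[cu ->] ->]].
  move=> /memv_addP[v1 v1h [v2 /vlineP[cv ->] ->]].
  rewrite lieDl !lieDr !lieZl !lieZr lie_alt abh // xz // (lieC x v1) xz //.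
  by rewrite oppr0 !scaler0 !addr0.
by rewrite -(maxh _ ab (addvSl _ _)) (subvP (addvSr h <[x]>)) // memv_line.
Qed.

Lemma lie_opp_root b x y : root_space b x -> root_space (- b) y ->
  exists z, [lie x, y] = vsval z.
Proof.
move=> bx by_; have := root_space_lie bx by_; rewrite subrr => /root_space0 m.
by exists (Subvs m).
Qed.

Lemma root_space_iter b c x v m : root_space b x -> root_space c v ->
  root_space (c + b *+ m) (iter m (lie x) v).
Proof.
move=> bx cv; elim: m => [|m IH]; first by rewrite mulr0n addr0.
by rewrite iterS mulrS addrCA; apply: root_space_lie.
Qed.

(** Root vectors are ad-nilpotent: the weights c + m b, for m natural, are
    pairwise distinct and only finitely many weights occur in g. *)
Lemma root_lie_nilp b x v : b != 0 -> root_space b x ->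
  exists m, iter m (lie x) v = 0.
Proof.
move=> b0 bx.
pose U : set g := [set v | exists m, iter m (lie x) v = 0].
have iterlin m : linear (iter m (lie x)).
  by elim: m => [//|m IH] a u w /=; rewrite IH linearP.
have iter0 m k u : (m <= k)%N -> iter m (lie x) u = 0 -> iter k (lie x) u = 0.
  by move=> /subnK <- u0; rewrite iterD u0 (lin0 (iterlin _)).
have sU : subspace U.
  split; first by exists 0%N.
  move=> a u w [m um] [k wk]; exists (maxn m k).
  by rewrite iterlin (iter0 _ _ _ (leq_maxl _ _) um) (iter0 _ _ _ (leq_maxr _ _)
    wk) scaler0 addr0.
rewrite -/(U v) [v]eE; apply: (subspace_sum sU) => i _; apply: (subspaceZ _ sU).
have [//|nU] := pselect (U e`_i).
have /choice[f fE] : forall m, exists j, eps j = eps i + b *+ m.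
  move=> m; have := root_space_iter m bx (eweight i).
  move/root_space_eps; apply.
  by apply: contra_notN nU => /eqP; exists m.
have finj : injective (fun m : 'I_n.+1 => f m).
  move=> m k /(congr1 eps); rewrite !fE => /addrI/eqP mk; apply/val_inj/eqP.
  move: mk; wlog lt : m k / (m <= k)%N => [WL|].
    by case: (leqP m k) => [|/ltnW] l;
      [apply: WL|rewrite eq_sym => /(WL _ _ l); rewrite eq_sym].
  rewrite -{1}(subnK lt) mulrnDr eq_sym -subr_eq0 addrK => /eqP d0.
  have [z bz] := cdual_neq b0; rewrite lfunE /= in bz.
  have : (b *+ (k - m)) z = 0 by rewrite d0 lfunE.
  rewrite cdualMn => /eqP; rewrite mulrn_eq0 (negbTE bz) orbF => km0.
  by rewrite eqn_leq lt -subn_eq0.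
by have := leq_card _ finj; rewrite !card_ord ltnn.
Qed.

(** Here y lowers weights by b and kills w, and z = [x, y]. *)
Lemma root_lowest_weight b c x y z w : b != 0 ->
  root_space b x -> root_space (- b) y -> [lie x, y] = vsval z ->
  root_space c w -> w != 0 -> [lie y, w] = 0 ->
  exists m : nat, c z *+ 2 = - (b z *+ m).
Proof.
move=> b0 bx by_ xy cw w0 yw.
apply: (@lowest_weight C g (lie x) (lie y) (lie (vsval z)) (b z)) w0 yw _ _.
- exact: lie_linearr.
- exact: lie_linearr.
- by move=> v; rewrite lie_lie xy.
- by move=> v; rewrite lie_lie bx lieZl.
- exact: cw.
exact: root_lie_nilp bx.
Qed.

(** For z = [x, y] with x and y of opposite root b, every weight c of g takes on
    z a value that is a half-integral multiple of b z: lower v as far as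
    possible. *)
Lemma weight_string b c x y z v : b != 0 ->
  root_space b x -> root_space (- b) y -> [lie x, y] = vsval z ->
  root_space c v -> v != 0 -> exists k m : nat, c z *+ 2 = b z *+ k - b z *+ m.
Proof.
move=> b0 bx by_ xy cv v0.
have [k yk] : exists k, iter k (lie y) v == 0.
  have b0' : - b != 0 by rewrite oppr_eq0.
  by have [k' yk'] := root_lie_nilp v b0' by_; exists k'; apply/eqP.
have Emin : exists k, iter k (lie y) v == 0 by exists k.
case: (ex_minnP Emin) => -[|k'] /eqP yk' kmin; first by rewrite [v]yk' eqxx in v0.
have w0 : iter k' (lie y) v != 0.
  by apply/negP => /kmin; rewrite ltnn.
have cw := root_space_iter k' by_ cv.
have [m em] := root_lowest_weight b0 bx by_ xy cw w0 yk'.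
exists k'.*2, m; move: em; rewrite add_lfunE cdualMn opp_lfunE.
by rewrite mulrnDl -mulrnA muln2 !mulNrn => /eqP; rewrite subr_eq addrC => /eqP.
Qed.

Lemma center0 z : (forall y, [lie vsval z, y] = 0) -> z = 0.
Proof.
move=> zc; pose J : set g := [set x | forall y, [lie x, y] = 0].
have sJ : subspace J.
  split=> [y|a u v Ju Jv y]; first exact: lie0r.
  by rewrite lieDl lieZl Ju Jv scaler0 addr0.
have [|J0|Jall] := simple_ideal hg sJ.
- by move=> x y Jy u; rewrite -lie_lie !Jy lier0 subr0.
- by apply/val_inj; rewrite /= (J0 (vsval z)).
by have [[x [y]]] := hg; rewrite Jall.
Qed.

(** If b z = 0, then by weight_string every weight vanishes on z, so z is
    central. *)
Lemma root_bracket_neq0 b x y z : b != 0 ->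
  root_space b x -> root_space (- b) y -> [lie x, y] = vsval z ->
  z != 0 -> b z != 0.
Proof.
move=> b0 bx by_ xy; apply: contra_neq => bz0; apply: center0 => v.
rewrite [v]eE (linear_sum (lie (vsval z))) big1 // => i _ /=.
have [e0|e0] := eqVneq e`_i 0; first by rewrite e0 scaler0 lier0.
have [k [m]] := weight_string b0 bx by_ xy (eweight i) e0.
rewrite bz0 !mul0rn subrr => /eqP; rewrite mulrn_eq0 /= => /eqP ei.
by rewrite lieZr eweight ei scale0r scaler0.
Qed.

(** Otherwise the root spaces would span an ideal without component in h. *)
Lemma exists_bracket : exists b x y z,
  [/\ b != 0, root_space b x, root_space (- b) y, [lie x, y] = vsval z & z != 0].
Proof.
case: (pselect (exists b x y z, [/\ b != 0, root_space b x, root_space (- b) y,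
  [lie x, y] = vsval z & z != 0])) => // nex; exfalso.
have lie0 b x y : b != 0 -> root_space b x -> root_space (- b) y -> [lie x, y] = 0.
  move=> b0 bx by_; have [z xy] := lie_opp_root bx by_.
  have [z0|z0] := eqVneq z 0; first by rewrite xy z0.
  by case: nex; exists b, x, y, z.
pose J : set g := [set x | forall i, eps i = 0 -> coord e i x = 0].
have sJ : subspace J.
  split=> [i _|a u v Ju Jv i i0]; first by rewrite linear0.
  by rewrite linearP /= Ju // Jv // mulr0 addr0.
have JE i : eps i != 0 -> J e`_i.
  move=> i0 j j0; rewrite (root_space_coord (eweight i)) // j0 eq_sym //.
have J_root b x : b != 0 -> root_space b x -> J x.
  by move=> b0 bx i i0; rewrite (root_space_coord bx) // i0 eq_sym.
have h0J : (forall y, J y) -> forall z, z = 0.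
  move=> Jall z; apply/val_inj; rewrite /= [vsval z]eE big1 // => i _.
  have [i0|i0] := eqVneq (eps i) 0; first by rewrite Jall // scale0r.
  rewrite (@root_space_coord 0) ?scale0r //; exact/root_space0/subvsP.
have [|J0|Jall] := simple_ideal hg sJ.
- move=> x y Jy; rewrite [y]eE (linear_sum (lie x)).
  apply: (subspace_sum sJ) => i _ /=; rewrite lieZr.
  have [i0|i0] := eqVneq (eps i) 0; first by rewrite Jy // scale0r; apply: sJ.1.
  apply: (subspaceZ _ sJ); rewrite lieC; apply: (subspaceN sJ).
  rewrite [x]eE (linear_sum (lie e`_i)); apply: (subspace_sum sJ) => j _ /=.
  rewrite lieZr; apply: (subspaceZ _ sJ).
  have [ij|ij] := eqVneq (eps i + eps j) 0.
    rewrite (@lie0 (eps i)) //; first exact: sJ.1.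
    have je : eps j = - eps i by apply/eqP; rewrite -addr_eq0 addrC ij.
    by have := eweight j; rewrite je.
  exact: (J_root _ _ ij (root_space_lie (eweight i) (eweight j))).
- have eps0 i : eps i = 0.
    apply/eqP/negPn/negP => i0; have := J0 _ (JE i i0).
    move=> e0; have := coord_free i i (basis_free ebasis).
    by rewrite e0 linear0 eqxx => /eqP; rewrite eq_sym oner_eq0.
  have gh x : x \in h.
    rewrite [x]eE; apply: rpred_sum => i _; apply: rpredZ.
    by apply/root_space0; rewrite -(eps0 i).
  have [[x [y xy]] _] := hg; have [abh _ _] := hh.
  by apply: xy; apply: abh.
have [[x [y xy]] _] := hg; apply: xy.
have eps0 i : eps i = 0 by apply/lfunP => z; rewrite (h0J Jall z) !linear0.
by rewrite [x]eE big1 ?lie0r // => i _; rewrite Jall ?scale0r.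
Qed.

(** Weights of g take integral values on a coroot z. *)
Lemma root_string_int b c x y z v : b != 0 ->
  root_space b x -> root_space (- b) y -> [lie x, y] = vsval z -> b z = 2 ->
  root_space c v -> v != 0 -> exists k : int, c z = k%:~R.
Proof.
move=> b0 bx by_ xy bz cv v0.
have [k [m]] := weight_string b0 bx by_ xy cv v0; rewrite bz => e2.
exists (k%:Z - m%:Z); rewrite intrB.
apply: (mulIf (_ : 2 != 0 :> C)); first by rewrite pnatr_eq0.
by rewrite mulr_natr e2 mulrBl -![2 *+ _]mulr_natl.
Qed.

Lemma sl2_normalize b x y z : [lie x, y] = vsval z -> b z != 0 ->
  [lie x, (2 / b z) *: y] = vsval ((2 / b z) *: z) /\ b ((2 / b z) *: z) = 2.
Proof.
move=> xy bz; rewrite lieZr xy; split=> //.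
by rewrite linearZ; exact: divfK.
Qed.

(** The Killing norm of a coroot is a positive integer. *)
Lemma root_string_norm b x y z : b != 0 -> x != 0 ->
  root_space b x -> root_space (- b) y -> [lie x, y] = vsval z -> b z = 2 ->
  exists2 N : nat, (0 < N)%N & \sum_i eps i z * eps i z = N%:R.
Proof.
move=> b0 x0 bx by_ xy bz.
have /choice[k kE] : forall i, exists k : int, eps i z = k%:~R.
  move=> i; apply: root_string_int b0 bx by_ xy bz (eweight i) _.
  apply/negP => /eqP e0; have := coord_free i i (basis_free ebasis).
  by rewrite e0 linear0 eqxx => /eqP; rewrite eq_sym oner_eq0.
have [j jb] := root_space_eps bx x0.
have sE : \sum_i eps i z * eps i z = (\sum_i k i ^+ 2)%:~R.
  by rewrite rmorph_sum; apply: eq_bigr => i _; rewrite kE -rmorphM.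
have kj : k j = 2.
  by apply/eqP; rewrite -(eqr_int C) -kE jb bz.
have s0 : 0 < \sum_i k i ^+ 2.
  rewrite (bigD1 j) //= kj ltr_pwDl // sumr_ge0 // => i _; exact: sqr_ge0.
exists `|(\sum_i k i ^+ 2)%R|%N; first by rewrite absz_gt0 gt_eqF.
by rewrite sE pmulrn gez0_abs // ltW.
Qed.

(** * The Killing form *)

(** The Killing form, the trace of ad x ad y computed in the basis e. *)
Definition killing x y := \sum_i coord e i [lie x, [lie y, e`_i]].

(** tr (f f') = tr (f' f). *)
Lemma killing_trace (f f' : g -> g) : linear f -> linear f' ->
  \sum_i coord e i (f (f' e`_i)) = \sum_i coord e i (f' (f e`_i)).
Proof.
move=> lf lf'.
have tE (f1 f2 : g -> g) : linear f1 -> \sum_i coord e i (f1 (f2 e`_i)) =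
    \sum_(i < n) \sum_(j < n) coord e j (f2 e`_i) * coord e i (f1 e`_j).
  move=> l1; apply: eq_bigr => i _; rewrite {1}[f2 _]eE (lin_sum l1) linear_sum.
  by apply: eq_bigr => j _; rewrite (linZ l1) linearZ.
rewrite (tE f f') // (tE f' f) // exchange_big; apply: eq_bigr => i _; apply:
  eq_bigr => j _.
exact: mulrC.
Qed.

Lemma killingC x y : killing x y = killing y x.
Proof. by apply: (@killing_trace (lie x) (lie y)); apply: lie_linearr. Qed.

Lemma killing_linear x : linear (killing x : g -> C^o).
Proof.
move=> a u v; rewrite /killing scaler_sumr -big_split; apply: eq_bigr => i _ /=.
by rewrite lieDl lieZl lieDr lieZr linearP.
Qed.

Lemma killing_linearl y : linear (killing^~ y : g -> C^o).
Proof. by move=> a u v; rewrite !(killingC _ y) killing_linear. Qed.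

Lemma killing_lie x y u : killing [lie x, y] u = killing x [lie y, u].
Proof.
rewrite /killing; under eq_bigr do rewrite -lie_lie linearB /=.
under [RHS]eq_bigr do rewrite -lie_lie lieDr lierN linearB /=.
rewrite !big_split /= !sumrN; congr (_ - _).
apply: (@killing_trace (lie y) (fun v => [lie x, [lie u, v]])).
  exact: lie_linearr.
by move=> a v w; rewrite lieDr lieZr lieDr lieZr.
Qed.

Lemma killing_h z z' :
  killing (vsval z) (vsval z') = \sum_i eps i z * eps i z'.
Proof.
apply: eq_bigr => i _; rewrite !coord_lie_h coord_free ?(basis_free ebasis) //.
by rewrite eqxx mulr1.
Qed.

Lemma killing_orthogonal b c x y : root_space b x -> root_space c y ->
  b + c != 0 -> killing x y = 0.
Proof.
move=> bx cy /cdual_neq[z]; rewrite add_lfunE zero_lfunE => bc.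
have := killing_lie x (vsval z) y; rewrite lieC bx cy -scaleNr.
rewrite (linZ (killing_linearl y)) (linZ (killing_linear x)) => /eqP.
rewrite -[_ *: _]/(_ * _) -[c z *: _]/(_ * _) eq_sym -subr_eq0 -mulrBl opprK.
by rewrite mulf_eq0 addrC (negbTE bc) => /eqP.
Qed.

(** The radical is an ideal; it is not g because coroots have positive norm. *)
Lemma killing_nondegenerate y : (forall x, killing x y = 0) -> y = 0.
Proof.
move: y; pose J : set g := [set y | forall x, killing x y = 0].
have sJ : subspace J.
  split=> [x|a u v Ju Jv x]; first exact: (lin0 (killing_linear x)).
  by rewrite killing_linear Ju Jv scaler0 addr0.
have [|//|Jall] := simple_ideal hg sJ.
  by move=> x y Jy u; rewrite -killing_lie.
have [b [x [y [z [b0 bx by_ xy z0]]]]] := exists_bracket.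
have bz := root_bracket_neq0 b0 bx by_ xy z0.
have x0 : x != 0.
  by apply: contra_neq z0 => x0; apply/val_inj; rewrite /= -xy x0 lie0r.
have [xy' bz'] := sl2_normalize xy bz.
have by' := subspaceZ (2 / b z) (root_space_subspace (- b)) by_.
have [N N0] := root_string_norm b0 x0 bx by' xy' bz'.
rewrite -killing_h Jall => /eqP; rewrite eq_sym pnatr_eq0 => /eqP N0'.
by rewrite N0' in N0.
Qed.

Lemma killing_nondegenerate_h z :
  (forall z', killing (vsval z') (vsval z) = 0) -> z = 0.
Proof.
move=> zk; apply/val_inj/killing_nondegenerate => x /=.
have h0 : root_space (0 : cdual h) (vsval z) by apply/root_space0/subvsP.
rewrite [x]eE (lin_sum (killing_linearl (vsval z))) big1 // => i _.
rewrite (linZ (killing_linearl _)).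
have [i0|i0] := eqVneq (eps i) 0; last first.
  by rewrite (killing_orthogonal (eweight i) h0) ?addr0 // scaler0.
have /root_space0 ih : root_space (0 : cdual h) e`_i by rewrite -i0.
by rewrite -[e`_i]/(vsval (Subvs ih)) zk scaler0.
Qed.

Lemma root_partner b y : b != 0 -> root_space (- b) y -> y != 0 ->
  exists x z, [/\ root_space b x, [lie x, y] = vsval z & z != 0].
Proof.
move=> b0 by_ y0.
have [i iy] : exists i : 'I_n, killing e`_i y != 0.
  apply/existsP; apply: contraNT y0; rewrite negb_exists => /forallP e0.
  apply/eqP/killing_nondegenerate => x; rewrite [x]eE.
  rewrite (lin_sum (killing_linearl y)) big1 // => i _.
  by rewrite (linZ (killing_linearl _)); move: (e0 i); rewrite negbK => /eqP->;
    rewrite scaler0.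
have ib : eps i = b.
  apply/eqP; rewrite -subr_eq0; apply: contraNT iy => ib.
  by rewrite (killing_orthogonal (eweight i) by_).
have bx : root_space b e`_i by rewrite -ib.
have [z xy] := lie_opp_root bx by_; exists e`_i, z; split=> //.
have [z' bz'] := cdual_neq b0; rewrite zero_lfunE in bz'.
apply: contra_neq bz' => z0; have := killing_lie (vsval z') e`_i y.
rewrite xy z0 bx (linZ (killing_linearl _)) (lin0 (killing_linear _)).
by move/eqP; rewrite -[_ *: _]/(_ * _) mulf_eq0 (negbTE iy) orbF => /eqP.
Qed.

(** This replaces the one-dimensionality of root spaces: if [x, y] = 0, then x
    is a lowest weight vector of positive weight for an sl2-triple that contains
    y. *)
Lemma root_lie_neq0 b x y : b != 0 -> root_space b x -> x != 0 ->
  root_space (- b) y -> y != 0 -> [lie x, y] != 0.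
Proof.
move=> b0 bx x0 by_ y0; apply/negP => /eqP xy.
have [x' [z [bx' x'y z0]]] := root_partner b0 by_ y0.
have bz := root_bracket_neq0 b0 bx' by_ x'y z0.
have [|m] := root_lowest_weight b0 bx' by_ x'y bx x0; first by rewrite lieC xy oppr0.
move/eqP; rewrite -addr_eq0 -mulrnDr mulrn_eq0 (negbTE bz) orbF.
by [].
Qed.

Lemma opp_root b : Defs.roots b -> Defs.roots (- b).
Proof.
move=> [b0 [y by_ y0]]; split.
  by move=> /eqP; rewrite oppr_eq0 => /eqP.
have by' : root_space (- - b) y by rewrite opprK.
have /eqP nb0 : - b != 0 by rewrite oppr_eq0; apply/eqP.
have [x [z [bx xy z0]]] := root_partner (introN eqP nb0) by' (introN eqP y0).
exists x => // x0; move/eqP: z0; apply; apply/val_inj; by rewrite /= -xy x0 lie0r.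
Qed.

Lemma sl2_triple b x y : b != 0 -> root_space b x -> x != 0 ->
  root_space (- b) y -> y != 0 ->
  exists (a : C) (z : subvs_of h), [lie x, a *: y] = vsval z /\ b z = 2.
Proof.
move=> b0 bx x0 by_ y0; have xy0 := root_lie_neq0 b0 bx x0 by_ y0.
have [z xy] := lie_opp_root bx by_.
have z0 : z != 0 by apply: contra_neq xy0 => z0; rewrite xy z0.
have bz := root_bracket_neq0 b0 bx by_ xy z0.
by have := sl2_normalize xy bz; exists (2 / b z), ((2 / b z) *: z).
Qed.

(** * A norm on weights, and its descent along roots *)

(** If t i represents eps i through the Killing form, the Killing form being the
    sum of the eps i (x) eps i on h, then the sum of the eps i (x) t i is the
    identity of h. *)
Lemma form_dual_expand (t : 'I_n -> subvs_of h) z :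
  (forall i z, killing (vsval z) (vsval (t i)) = eps i z) ->
  z = \sum_i eps i z *: t i.
Proof.
move=> kt; apply/eqP; rewrite -subr_eq0; apply/eqP/killing_nondegenerate_h => z'.
rewrite (linearB vsval) (linB (killing_linear _)) (linear_sum vsval).
rewrite (lin_sum (killing_linear _)) killing_h -sumrB big1 // => i _.
by rewrite (linearZ_LR vsval) (linZ (killing_linear _)) kt -[_ *:
  _]/(_ * _) mulrC subrr.
Qed.

Section Form.
(* H i is the coroot of eps i; nothing is assumed when eps i = 0. *)
Variable H : 'I_n -> subvs_of h.
Hypothesis HP : forall i, eps i != 0 -> exists x y,
  [/\ x != 0, root_space (eps i) x, root_space (- eps i) y,
      [lie x, y] = vsval (H i) & eps i (H i) = 2].

(** The representative t i of a root eps i is 2 H i / N i, where N i is the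
    Killing norm of H i; that of the weight 0 is 0. *)
Lemma form_dual : exists (N : 'I_n -> nat) (t : 'I_n -> subvs_of h),
  [/\ forall i, (0 < N i)%N,
      forall i, t i = if eps i == 0 then 0 else (2 / (N i)%:R) *: H i
    & forall i z, killing (vsval z) (vsval (t i)) = eps i z].
Proof.
have /choice[N NP] : forall i, exists N, (0 < N)%N /\
    (eps i != 0 -> forall z, (N%:R :
      C) * eps i z = 2 * killing (vsval z) (vsval (H i))).
  move=> i; have [i0|i0] := eqVneq (eps i) 0; first by exists 1%N.
  have [x [y [x0 ix iy xy iz]]] := HP i0.
  have [N N0 EN] := root_string_norm i0 x0 ix iy xy iz.
  exists N; split=> // _ z; have kE z' :
    killing (vsval z') (vsval (H i)) = eps i z' * killing x y.
    by rewrite -xy -killing_lie ix (linZ (killing_linearl _)).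
  rewrite -EN -killing_h !kE iz; ring.
exists N, (fun i => if eps i == 0 then 0 else (2 / (N i)%:R) *: H i).
split=> // [i|i z]; first by have [] := NP i.
case: ifPn => [/eqP->|i0].
  by rewrite zero_lfunE (lin0 (killing_linear _)).
have [N0 /(_ i0 z) NE] := NP i; rewrite (linZ (killing_linear _)).
have Nn0 : (N i)%:R != 0 :> C by rewrite pnatr_eq0 -lt0n.
apply: (mulfI Nn0); rewrite NE -[_ *: _]/(_ * _); field.
by [].
Qed.

(** A nonempty set X of integral weights contains one, mu, from which X cannot
    be reached by subtracting a root with mu (H i) >= 2, nor by adding a root
    with mu (H i) <= - 2. Take mu of minimal norm Q mu mu, the sum of the
    squares of the mu (t i): Q (mu + s eps i) - Q mu = (s k + s^2) 4 / N i for k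
    = mu (H i), and the norms have bounded denominators. *)
Lemma form_descent (X : set (cdual h)) : X !=set0 ->
  (forall mu, X mu -> forall i, eps i != 0 -> exists k : int, mu (H i) = k%:~R) ->
  exists2 mu, X mu & forall i (k : int), eps i != 0 -> mu (H i) = k%:~R ->
    (2 <= k -> ~ X (mu - eps i)) /\ (k <= - 2 -> ~ X (mu + eps i)).
Proof.
move=> [mu0 Xmu0] Xint; have [N [t [N0 tE kt]]] := form_dual.
have decz z := form_dual_expand z kt.
pose Q (mu nu : cdual h) := \sum_i mu (t i) * nu (t i) : C.
have Qeps mu j : Q mu (eps j) = mu (t j).
  rewrite [in RHS](decz (t j)) linear_sum; apply: eq_bigr => i _; rewrite linearZ /=.
  by rewrite -!kt killingC [RHS]mulrC.
have QD (mu nu : cdual h) (c : C) :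
  Q (mu + c *: nu) (mu + c *: nu) = Q mu mu + 2 * c * Q mu nu + c * c * Q nu nu.
  rewrite /Q !mulr_sumr -!big_split; apply: eq_bigr => i _ /=.
  rewrite !(add_lfunE, scale_lfunE) -[_ *: _]/(_ * _); ring.
have tj j (k : int) (mu : cdual h) : eps j != 0 -> mu (H j) = k%:~R ->
  mu (t j) = 2 / (N j)%:R * k%:~R.
  by move=> j0 mk; rewrite tE (negbTE j0) linearZ /= mk.
have Nn0 j : (N j)%:R != 0 :> C by rewrite pnatr_eq0 -lt0n.
(* P^2 clears the denominators of all norms. *)
pose P := (\prod_i N i)%N.
have P0 : 0 < P%:R :> C by rewrite ltr0n prodn_gt0.
have Qnat mu : X mu -> exists m : nat, P%:R ^+ 2 * Q mu mu = m%:R.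
  move=> Xmu.
  have /choice[k kE] : forall i, exists k : int, P%:R * mu (t i) = k%:~R.
    move=> i; have [i0|i0] := eqVneq (eps i) 0.
      by exists 0; rewrite tE i0 eqxx linear0 mulr0.
    have [k kE] := Xint _ Xmu i i0; rewrite (tj _ _ _ i0 kE).
    exists (2 * (\prod_(j | j != i) N j)%N%:Z * k).
    rewrite /P (bigD1 i) //= natrM !intrM -!pmulrn; field.
    exact: Nn0.
  exists `|(\sum_i k i ^+ 2)%R|%N; rewrite [RHS]pmulrn gez0_abs; last first.
    by apply: sumr_ge0 => i _; apply: sqr_ge0.
  rewrite rmorph_sum mulr_sumr; apply: eq_bigr => i _.
  rewrite rmorphXn /= -kE; ring.
have [m0 Em0] := Qnat _ Xmu0.
pose good m := `[< exists2 mu, X mu & P%:R ^+ 2 * Q mu mu = m%:R >].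
have gex : exists m, good m by exists m0; apply/asboolP; exists mu0.
case: (ex_minnP gex) => m /asboolP[mu Xmu Em] mmin; exists mu => // i k i0 ki.
have key (s : C) : 2 * s * k%:~R + 2 * s * s < 0 -> ~ X (mu + s *: eps i).
  move=> sneg Xs; have [m' Em'] := Qnat _ Xs.
  have : (m <= m')%N by apply: mmin; apply/asboolP; exists (mu + s *: eps i).
  rewrite -(ler_nat C) -Em -Em' ler_pM2l ?exprn_gt0 //.
  rewrite QD !Qeps (tj _ _ _ i0 ki).
  have [x [y [_ _ _ _ ii]]] := HP i0.
  rewrite (tj i 2 (eps i) i0 ii) -addrA lerDl.
  have -> : 2 * s * (2 / (N i)%:R * k%:~R) + s * s * (2 / (N i)%:R * 2%:~R) =
     (2 * s * k%:~R + 2 * s * s) * (2 / (N i)%:R) :> C.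
    by field; apply: Nn0.
  rewrite pmulr_lge0 ?divr_gt0 ?ltr0n // => /(lt_le_trans sneg).
  by rewrite ltxx.
split=> k2.
  have := key (- 1); rewrite scaleN1r; apply.
  rewrite -[X in X < _](_ : ((1 - k) * 2)%:~R = _); last first.
    rewrite intrM intrB; ring.
  by rewrite ltrz0 pmulr_llt0 // subr_lt0; apply: lt_le_trans k2.
have := key 1; rewrite scale1r; apply.
rewrite -[X in X < _](_ : ((1 + k) * 2)%:~R = _); last first.
  rewrite intrM intrD; ring.
rewrite ltrz0 pmulr_llt0 // -ltrBrDl sub0r; apply: le_lt_trans k2 _; by [].
Qed.

(** A weight that vanishes on all coroots is 0. *)
Lemma coroots_span (mu : cdual h) :
  (forall i, eps i != 0 -> mu (H i) = 0) -> mu = 0.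
Proof.
move=> mu0; have [N [t [_ tE kt]]] := form_dual.
apply/lfunP => z; rewrite zero_lfunE.
rewrite (form_dual_expand z kt) linear_sum big1 // => i _; rewrite linearZ /= tE.
case: ifPn => [_|i0]; first by rewrite linear0 !(scaler0, mulr0).
by rewrite linearZ /= mu0 // !scaler0.
Qed.

End Form.

End RootSpaces.

(** * Direct sums of families of subspaces *)

Section DirectSums.
Variables (K : fieldType) (V : lmodType K).
Implicit Types (J : choiceType) (U A B : set V).

Lemma fsbig_uniq_seq J (f : J -> V) (s : seq J) : uniq s ->
  (forall j, f j != 0 -> j \in s) ->
  \sum_(j \in [set: J]) f j = \sum_(j <- s) f j.
Proof.
move=> us fs; apply/esym; rewrite fsbig_seq //; apply: fsbig_widen => //.
by move=> j [_ /= /negP js]; apply/eqP; apply: contraNT js => /fs.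
Qed.

(** U is the direct sum of the M j, expressed by sums over duplicate-free
    sequences of indices. *)
Definition seq_direct J (M : J -> set V) U :=
  (forall v, U v <-> exists (s : seq J) (f : J -> V),
     [/\ uniq s, forall j, j \in s -> M j (f j) & v = \sum_(j <- s) f j]) /\
  (forall (s : seq J) (f : J -> V), uniq s -> (forall j, j \in s -> M j (f j)) ->
     \sum_(j <- s) f j = 0 -> forall j, j \in s -> f j = 0).

Lemma seq_directP J (M : J -> set V) U : (forall j, M j 0) ->
  direct_sum setT M U <-> seq_direct M U.
Proof.
move=> M0.
have cut (s : seq J) (f : J -> V) : uniq s ->
    \sum_(j \in [set: J]) (if j \in s then f j else 0) = \sum_(j <- s) f j.
  move=> us; rewrite (@fsbig_uniq_seq _ _ s) // => [|j]; last first.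
    by case: (j \in s); rewrite ?eqxx.
  by apply: eq_big_seq => j ->.
have cut_fin (s : seq J) (f : J -> V) : (forall j, j \in s -> M j (f j)) ->
    fin_family setT M (fun j => if j \in s then f j else 0).
  move=> Mf; split=> [|j _]; last by case: ifP => [/Mf|_].
  apply: (@sub_finite_set _ _ [set` s]); last exact: finite_seq.
  by move=> j /= [_]; case: (j \in s); rewrite ?eqxx.
have supp (f : J -> V) : fin_family setT M f ->
    exists2 s, uniq s & forall j, f j != 0 -> j \in s.
  move=> [ff _]; exists (fset_set [set j | setT j /\ f j != 0]).
    exact: fset_uniq.
  by move=> j fj; rewrite in_fset_set // inE /=.
split=> [[<- ind]|[UE ind]]; split.
- move=> v; split=> [[f ff ->]|[s [f [us Mf ->]]]].
    have [s us fs] := supp f ff; exists s, f; split=> //; last exact: fsbig_uniq_seq.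
    by move=> j _; apply: ff.2.
  by rewrite -cut //; exists (fun j => if j \in s then f j else 0) => //; apply:
    cut_fin.
- move=> s f us Mf s0 j js.
  by have := ind _ (cut_fin s f Mf); rewrite cut // => /(_ s0 j I); rewrite js.
- apply/seteqP; split=> v.
    move=> [f ff ->]; have [s us fs] := supp f ff; apply/UE; exists s, f.
    by split=> [//||]; [move=> j _; apply: ff.2|exact: fsbig_uniq_seq].
  move/UE => [s [f [us Mf ->]]]; rewrite -cut //.
  by exists (fun j => if j \in s then f j else 0) => //; apply: cut_fin.
move=> f ff f0 j _; have [s us fs] := supp f ff.
have [js|js] := boolP (j \in s); last first.
  by apply/eqP; apply: contraNT js => /fs.
apply: (ind s f) => //; last by rewrite -(fsbig_uniq_seq us fs).
by move=> k _; apply: ff.2.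
Qed.

Lemma seq_direct_bij J J' (p : J' -> J) (M : J -> set V) U : bijective p ->
  seq_direct M U -> seq_direct (M \o p) U.
Proof.
move=> [q pK qK] [UE ind]; split=> [v|s f us Mf s0 j js].
  rewrite UE; split=> [[s [f [us Mf ->]]]|[s [f [us Mf ->]]]].
    exists (map q s), (f \o p); split.
    - by rewrite (map_inj_uniq (can_inj qK)).
    - by move=> _ /mapP[j js ->] /=; rewrite qK; apply: Mf.
    by rewrite big_map; apply: eq_bigr => j _ /=; rewrite qK.
  exists (map p s), (f \o q); split.
  - by rewrite (map_inj_uniq (can_inj pK)).
  - by move=> _ /mapP[j js ->] /=; rewrite pK; apply: Mf.
  by rewrite big_map; apply: eq_bigr => j _ /=; rewrite pK.
have -> : f j = (f \o q) (p j) by rewrite /= pK.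
apply: (ind (map p s)).
- by rewrite (map_inj_uniq (can_inj pK)).
- by move=> _ /mapP[k ks ->] /=; rewrite pK; apply: Mf.
- by rewrite big_map -[RHS]s0; apply: eq_bigr => k _ /=; rewrite pK.
by rewrite map_f.
Qed.

(** The family on a disjoint union of index types given by two families. *)
Definition sum_family J1 J2 (M1 : J1 -> set V) (M2 : J2 -> set V)
    (j : J1 + J2) : set V :=
  match j with inl j1 => M1 j1 | inr j2 => M2 j2 end.

Lemma seq_direct_sum J1 J2 (M1 : J1 -> set V) (M2 : J2 -> set V) A B U :
  subspace A -> subspace B -> direct_sum2 A B U ->
  seq_direct M1 A -> seq_direct M2 B -> seq_direct (sum_family M1 M2) U.
Proof.
move=> sA sB /(direct_sum2E _ sA sB)[<- dAB] [AE indA] [BE indB].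
pose pl (j : J1 + J2) := if j is inl j1 then Some j1 else None.
pose pr (j : J1 + J2) := if j is inr j2 then Some j2 else None.
have plK : ocancel pl inl by case.
have prK : ocancel pr inr by case.
have ul (s : seq (J1 + J2)) : uniq s -> uniq (pmap pl s).
  exact: (pmap_uniq plK).
have ur (s : seq (J1 + J2)) : uniq s -> uniq (pmap pr s).
  exact: (pmap_uniq prK).
have split_sum (s : seq (J1 + J2)) (f : J1 + J2 -> V) :
    \sum_(j <- s) f j =
    \sum_(j <- pmap pl s) f (inl j) + \sum_(j <- pmap pr s) f (inr j).
  elim: s => [|[j|j] s IH] /=; first by rewrite !big_nil addr0.
    by rewrite !big_cons IH addrA.
  by rewrite !big_cons IH addrCA.
have meml (s : seq (J1 + J2)) j : (j \in pmap pl s) = (inl j \in s).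
  rewrite mem_pmap; apply/mapP/idP => [[[k|k] ks] //= [->] //|js].
  by exists (inl j).
have memr (s : seq (J1 + J2)) j : (j \in pmap pr s) = (inr j \in s).
  rewrite mem_pmap; apply/mapP/idP => [[[k|k] ks] //= [->] //|js].
  by exists (inr j).
split=> [v|s f us Mf s0].
  split=> [/sum_setE[a [b [/AE[s1 [f1 [us1 M1f ->]]] /BE[s2 [f2 [us2 M2f ->]]]
    ->]]]|].
    exists (map inl s1 ++ map inr s2),
      (fun j => match j with inl j1 => f1 j1 | inr j2 => f2 j2 end); split.
    - rewrite cat_uniq !map_inj_uniq ?us1 ?us2 ?andbT; try by move=> ? ? [].
      by apply/hasPn => _ /mapP[j _ ->]; apply/negP => /mapP[].
    - by move=> j; rewrite mem_cat => /orP[] /mapP[k ks ->]; [apply: M1f|apply: M2f].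
    by rewrite big_cat !big_map.
  move=> [s [f [us Mf ->]]]; rewrite split_sum; apply/sum_setE.
  exists (\sum_(j <- pmap pl s) f (inl j)), (\sum_(j <- pmap pr s) f (inr j)).
  split=> //.
    apply/AE; exists (pmap pl s), (f \o inl); split=> //.
      exact: ul.
    by move=> j; rewrite meml => /Mf.
  apply/BE; exists (pmap pr s), (f \o inr); split=> //.
    exact: ur.
  by move=> j; rewrite memr => /Mf.
have Al : A (\sum_(j <- pmap pl s) f (inl j)).
  apply/AE; exists (pmap pl s), (f \o inl); split=> //.
    exact: ul.
  by move=> j; rewrite meml => /Mf.
have Br : B (\sum_(j <- pmap pr s) f (inr j)).
  apply/BE; exists (pmap pr s), (f \o inr); split=> //.
    exact: ur.
  by move=> j; rewrite memr => /Mf.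
rewrite split_sum in s0.
have l0 : \sum_(j <- pmap pl s) f (inl j) = 0.
  apply: dAB => //; rewrite -(addrK (\sum_(j <- pmap pr s) f (inr j)) (\sum_(j <-
    _) _)).
  by rewrite s0 sub0r; apply: subspaceN.
rewrite l0 add0r in s0.
case=> j js.
  apply: (indA (pmap pl s) (f \o inl)) => //; last by rewrite meml.
    exact: ul.
  by move=> k; rewrite meml => /Mf.
apply: (indB (pmap pr s) (f \o inr)) => //; last by rewrite memr.
  exact: ur.
by move=> k; rewrite memr => /Mf.
Qed.

End DirectSums.

(** * A dimension count for arbitrary subspaces *)

Section FiniteSpan.
Variables (K : fieldType) (V : lmodType K).

(** The dimension of the space of coefficients c such that the combination of
    the b i lies in A. It is strictly monotone at inclusions A <= M that differ
    on the span of b, whatever the dimensions of A and M. *)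
Lemma dimension_measure N (b : 'I_N -> V) : exists d : set V -> nat,
  forall A M : set V, subspace A -> subspace M -> A `<=` M ->
  (exists c : 'I_N -> K, M (\sum_i c i *: b i) /\ ~ A (\sum_i c i *: b i)) ->
  (d A < d M)%N.
Proof.
have /choice[U UP] : forall A : set V, exists U : {vspace 'rV[K]_N},
    subspace A -> forall c, c \in U <-> A (\sum_i c 0 i *: b i).
  move=> A; have [sA|nA] := pselect (subspace A); last by exists 0%VS.
  have [|U UP] := @subspace_vspace K 'rV[K]_N
      [set c : 'rV[K]_N | A (\sum_i c 0 i *: b i)]; last by exists U.
  split=> [|a u v Au Av] /=.
    by rewrite big1 ?sA.1 // => [|i _]; [apply: sA.1|rewrite mxE scale0r].
  rewrite (_ : \sum_i _ = a *: (\sum_i u 0 i *: b i) + \sum_i v 0 i *: b i).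
    exact: sA.2.
  rewrite scaler_sumr -big_split; apply: eq_bigr => i _.
  by rewrite !mxE scalerDl scalerA.
exists (fun A => \dim (U A)) => A M sA sM AM [c [Mc Ac]].
have row : \sum_i (\row_j c j) 0 i *: b i = \sum_i c i *: b i.
  by apply: eq_bigr => i _; rewrite mxE.
have UAM : (U A <= U M)%VS.
  by apply/subvP => v /(UP A sA) Av; apply/(UP M sM)/AM.
rewrite ltn_neqAle dimvS // andbT; apply/negP => /eqP dAM.
have e : U A = U M by apply/eqP; rewrite eqEdim UAM dAM leqnn.
apply: Ac; rewrite -row; apply/(UP A sA); rewrite e; apply/(UP M sM).
by rewrite row.
Qed.

(** Finitely many finite dimensional subspaces lie in the span of a finite
    family. *)
Lemma fin_dim_span (T : eqType) (F : T -> set V) (S : seq T) :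
  (forall l, l \in S -> fin_dim (F l)) ->
  exists N (b : 'I_N -> V), forall l, l \in S -> forall v, F l v ->
    exists c : 'I_N -> K, v = \sum_i c i *: b i.
Proof.
elim: S => [|l S IH] FS.
  by exists 0%N, (fun _ => 0).
have [|N [b bP]] := IH; first by move=> k kS; apply: FS; rewrite inE kS orbT.
have [N' [b' [_ b'P]]] := FS l (mem_head _ _).
exists (N' + N)%N, (fun i => match fintype.split i with inl j => b' j | inr j =>
  b j end).
move=> k; rewrite inE => /orP[/eqP->|kS] v Fv.
  have [c ->] := b'P v Fv.
  exists (fun i => match fintype.split i with inl j => c j | inr _ => 0 end).
  rewrite big_split_ord /= [X in _ + X]big1 ?addr0.
    by apply: eq_bigr => i _; rewrite -[lshift _ _]/(unsplit (inl i)) unsplitK.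
  by move=> i _; rewrite -[rshift _ _]/(unsplit (inr i)) unsplitK scale0r.
have [c ->] := bP k kS v Fv.
exists (fun i => match fintype.split i with inl _ => 0 | inr j => c j end).
rewrite big_split_ord /= [X in X + _]big1 ?add0r.
  by apply: eq_bigr => i _; rewrite -[rshift _ _]/(unsplit (inr i)) unsplitK.
by move=> i _; rewrite -[lshift _ _]/(unsplit (inl i)) unsplitK scale0r.
Qed.

End FiniteSpan.

(** * Subspaces stable under the extended Cartan subalgebra *)

(** A finite part of the union of a chain lies in one member of the chain. *)
Lemma chain_seq (T : eqType) (F : set (set T)) (s : seq T) :
  total_on F subset -> (forall v, v \in s -> (\bigcup_(X in F) X) v) ->
  s = [::] \/ exists2 X, F X & forall v, v \in s -> X v.
Proof.
move=> tF; elim: s => [|v s IH] Fs; [by left|right].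
have [X FX Xv] := Fs v (mem_head _ _).
have [|->|[Y FY Ys]] := IH.
- by move=> w ws; apply: Fs; rewrite inE ws orbT.
- by exists X => // w; rewrite inE => /eqP->.
have [XY|YX] := tF _ _ FX FY.
  by exists Y => // w; rewrite inE => /orP[/eqP->|/Ys]; [apply: XY|].
by exists X => // w; rewrite inE => /orP[/eqP->|/Ys /YX].
Qed.

Section Weights.
Variables (C : numClosedFieldType) (g : finLieAlgType C) (h : {vspace g}).
Variables (V : lmodType C) (rho : lie_action (loope g) V).
Hypothesis wdec : direct_sum setT (weight_space (h := h) rho) setT.
Implicit Types (U A B M : set V) (l : ewt h) (z : subvs_of h).

Let hop (x : subvs_of h * C) (v : V) := rho (mono (vsval x.1) 0, x.2) v.
Let hev l (x : subvs_of h * C) : C := l.1 x.1 + l.2 * x.2.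

(** Stability under h_e = h + C d. *)
Definition he_stable U :=
  forall z (a : C) u, U u -> U (rho (mono (vsval z) 0, a) u).

Lemma weight_space_subspace l : subspace (weight_space rho l).
Proof.
split=> [z a|a u v lu lv z c]; first by rewrite scaler0 (lin0 (act_linearr rho _)).
by rewrite act_linearr lu lv scalerDr !scalerA mulrC.
Qed.

Lemma ewt_separated l l' : l != l' -> exists x, hev l x != hev l' x.
Proof.
case: l l' => [b s] [b' s']; rewrite /hev /=.
have [->|ss'] := eqVneq s s'.
  have [->|bb'] := eqVneq b b'; first by rewrite eqxx.
  by have [z bz] := cdual_neq bb'; exists (z, 0); rewrite !mulr0 !addr0.
by exists (0, 1); rewrite /= !linear0 !add0r !mulr1.
Qed.

Lemma weight_decomp v : exists (s : seq (ewt h)) (f : ewt h -> V),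
  [/\ uniq s, forall l, l \in s -> weight_space rho l (f l) &
      v = \sum_(l <- s) f l].
Proof.
have [|VE _] := (seq_directP _ _).1 wdec.
  by move=> l; apply: (weight_space_subspace l).1.
exact/VE.
Qed.

(** An h_e-stable subspace is spanned by its weight vectors. *)
Lemma stable_spanned U A : subspace U -> he_stable U -> subspace A ->
  (forall l v, U v -> weight_space rho l v -> A v) -> U `<=` A.
Proof.
move=> sU hU sA UA v Uv; have [s [f [us fs ev]]] := weight_decomp v.
rewrite ev; apply: subspace_sum => // l ls; apply: (UA l); last exact: fs.
apply: (@eigen_components C V _ _ hop hev U _ ewt_separated sU _ s f us) ls => //.
- by move=> x; apply: act_linearr.
- by move=> x u; apply: hU.
- by move=> k /fs kf x; apply: kf.
by rewrite -ev.
Qed.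

(** If A and B are h_e-stable with A `&` B = 0, then A has an h_e-stable
    complement that contains B. Zorn's lemma gives a maximal h_e-stable U
    containing B with A `&` U = 0, and a weight vector outside A + U could be
    added to U. *)
Lemma stable_complement A B : subspace A -> he_stable A ->
  subspace B -> he_stable B -> (forall v, A v -> B v -> v = 0) ->
  exists U, [/\ subspace U, he_stable U, B `<=` U,
    forall v, A v -> U v -> v = 0 & sum_set A U = setT].
Proof.
move=> sA hA sB hB AB.
pose good U := [/\ subspace U, he_stable U, B `<=` U &
  forall v, A v -> U v -> v = 0].
(* The empty set is admitted because it is the union of the empty chain. *)
pose P U := U = set0 \/ good U.
have [F FP tF|U [PU Umax]] := @Zorn_bigcup V P.
  have [[X0 FX0 X00]|F0] := pselect (exists2 X, F X & X !=set0); last first.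
    left; apply/seteqP; split=> // v [X FX Xv]; case: F0.
    by exists X => //; exists v.
  have gX X v : F X -> X v -> good X.
    by move=> /FP[->|//].
  have [v0 Xv0] := X00; have [sX hX BX AX] := gX _ _ FX0 Xv0.
  right; split.
  - split=> [|a u v [X FX Xu] [Y FY Yv]]; first by exists X0 => //; apply: sX.1.
    have [XY|YX] := tF _ _ FX FY.
      exists Y => //; have [sY _ _ _] := gX _ _ FY Yv.
      by apply: sY.2 => //; apply: XY.
    exists X => //; have [sX' _ _ _] := gX _ _ FX Xu.
    by apply: sX'.2 => //; apply: YX.
  - move=> z a u [X FX Xu]; exists X => //.
    by have [_ hX' _ _] := gX _ _ FX Xu; apply: hX'.
  - by move=> v /BX; exists X0.
  by move=> v Av [X FX Xv]; have [_ _ _ AX'] := gX _ _ FX Xv; apply: AX'.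
have [sU hU BU AU] : good U.
  case: PU => // U0; exfalso; apply: (Umax B); last by right; split.
  by rewrite U0; split=> // /(_ 0 sB.1).
exists U; split=> //.
suff sub : setT `<=` sum_set A U by apply/seteqP; split=> // v _; apply: sub.
have sAU := subspace_sum_set sA sU.
apply: stable_spanned => // l v _ lv; case: (pselect (sum_set A U v)) => // nv.
exfalso; pose L : set V := [set c *: v | c in setT].
have sL : subspace L.
  split=> [|a _ _ [c _ <-] [d _ <-]]; first by exists 0; rewrite ?scale0r.
  by exists (a * c + d); rewrite // scalerDl scalerA.
apply: (Umax (sum_set U L)).
  split=> [u Uu|sub].
    by apply/sum_setE; exists u, 0; rewrite addr0; split=> //; apply: sL.1.
  apply: nv; apply/sum_setE; exists 0, v; rewrite add0r; split=> //.
    exact: sA.1.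
  apply: sub; apply/sum_setE; exists 0, v; rewrite add0r; split=> //.
    exact: sU.1.
  by exists 1; rewrite ?scale1r.
right; split.
- exact: subspace_sum_set.
- move=> z a _ /sum_setE[u [_ [Uu [c _ <-] ->]]].
  rewrite (linD (act_linearr rho _)) (linZ (act_linearr rho _)) lv scalerA.
  apply/sum_setE; exists (rho (mono (vsval z) 0, a) u).
  exists ((c * (l.1 z + l.2 * a)) *: v); split=> //; first exact: hU.
  by eexists; last reflexivity.
- move=> u /BU Uu; apply/sum_setE; exists u, 0; rewrite addr0; split=> //.
  exact: sL.1.
move=> w Aw /sum_setE[u [_ [Uu [c _ <-] e]]].
have [c0|c0] := eqVneq c 0.
  by move: Aw; rewrite e c0 scale0r addr0 => Au; apply: AU.
exfalso; apply: nv; have -> : v = c^-1 *: (u + c *: v) + (- c^-1) *: u.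
  by rewrite scalerDr scalerA mulVf // scale1r addrC scaleNr addrA addNr add0r.
apply: subspaceD => //; apply: subspaceZ => //; apply/sum_setE.
  by exists (u + c *: v), 0; rewrite addr0 -{1}e; split=> //; apply: sU.1.
by exists 0, u; rewrite add0r; split=> //; apply: sA.1.
Qed.

(** An h_e-stable subspace is the direct sum of the lines spanned by the
    elements of a maximal linearly independent set B of weight vectors. *)
Lemma line_decomposition U : subspace U -> he_stable U ->
  exists B : set V, (forall v, B v ->
    [/\ v != 0, U v & exists l, weight_space rho l v]) /\
    seq_direct (fun j : {v : V | v \in B} => [set c *: val j | c in setT]) U.
Proof.
move=> sU hU.
pose indep B := forall (s : seq V) (c : V -> C), uniq s ->
  (forall v, v \in s -> B v) -> \sum_(v <- s) c v *: v = 0 ->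
  forall v, v \in s -> c v = 0.
pose wv B := forall v, B v -> U v /\ exists l, weight_space rho l v.
have [F FP tF|B [[wB iB] Bmax]] := @Zorn_bigcup V [set B | wv B /\ indep B].
  split=> [v [X FX Xv]|s c us Fs s0]; first by have [wX _] := FP X FX; apply: wX.
  have [->//|[X FX Xs]] := chain_seq tF Fs.
  by have [_ iX] := FP X FX; apply: iX.
have B0 v : B v -> v != 0.
  move=> Bv; apply/negP => /eqP v0.
  have := iB [:: v] (fun _ => 1) isT; rewrite big_seq1 scale1r =>
    /(_ _ v0 v (mem_head _ _)).
  move=> H; suff /eqP : (1 : C) = 0 by rewrite oner_eq0.
  by apply: H => w; rewrite inE => /eqP->.
pose S : set V := [set v | exists (s : seq V) (c : V -> C),
  [/\ uniq s, forall w, w \in s -> B w & v = \sum_(w <- s) c w *: w]].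
have cutS v : S v -> exists (s : seq V) (c : V -> C),
  [/\ uniq s, forall w, w \in s -> B w, forall w, w \notin s -> c w = 0 &
    v = \sum_(w <- s) c w *: w].
  move=> [s [c [us Bs ->]]]; exists s, (fun w => if w \in s then c w else 0).
  split=> //; first by move=> w /negbTE->.
  by apply: eq_big_seq => w ->.
have sS : subspace S.
  split; first by exists [::], (fun _ => 0); rewrite big_nil.
  move=> a u v /cutS[s [c [us Bs cs ->]]] /cutS[t [d [ut Bt dt ->]]].
  exists (undup (s ++ t)), (fun w => a * c w + d w); split.
  - exact: undup_uniq.
  - by move=> w; rewrite mem_undup mem_cat => /orP[/Bs|/Bt].
  have ext (r : seq V) (k : V -> C) : uniq r -> (forall w, w \notin r -> k w = 0) ->
      {subset r <= s ++ t} ->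
      \sum_(w <- r) k w *: w = \sum_(w <- undup (s ++ t)) k w *: w.
    move=> ur kr rst; pose f w := k w *: w.
    have fr w : f w != 0 -> w \in r.
      by apply: contraR => /kr kw; rewrite /f kw scale0r.
    rewrite -(fsbig_uniq_seq ur fr); apply: fsbig_uniq_seq; first exact: undup_uniq.
    by move=> w /fr/rst; rewrite mem_undup.
  rewrite (ext s c) ?(ext t d) // => [|w wt|w ws];
    try by rewrite mem_cat ?wt ?ws ?orbT.
  rewrite scaler_sumr -big_split; apply: eq_bigr => w _.
  by rewrite scalerDl scalerA.
have BS v : B v -> S v.
  move=> Bv; exists [:: v], (fun _ => 1); rewrite big_seq1 scale1r; split=> //.
  by move=> w; rewrite inE => /eqP->.
have US : U `<=` S.
  apply: stable_spanned => // l w Uw lw; case: (pselect (S w)) => // nw; exfalso.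
  apply: (Bmax (B `|` [set w])).
    split=> [v Bv|sub]; [by left|apply: nw; apply: BS; apply: sub; by right].
  split=> [v [/wB//|->]|s c us Bs s0 v vs]; first by split=> //; exists l.
  have [ws|ws] := boolP (w \in s); last first.
    apply: (iB s c us) => // u us'; case: (Bs u us') => // uw.
    by rewrite -uw us' in ws.
  have Brem u : u \in rem w s -> B u.
    rewrite mem_rem_uniq // inE => /andP[uw us']; case: (Bs u us') => // uw'.
    by rewrite uw' eqxx in uw.
  move: s0; rewrite (big_rem w) //=; set r := \sum_(_ <- rem w s) _ => s0.
  have cw : c w = 0.
    apply/eqP/negPn/negP => cw; apply: nw.
    have -> : w = - (c w)^-1 *: r.
      have -> : r = - (c w *: w) by apply/eqP; rewrite -addr_eq0 addrC s0.
      by rewrite scaleNr scalerN opprK scalerA mulVf // scale1r.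
    apply: subspaceZ => //; exists (rem w s), c; split=> //; exact: rem_uniq.
  have [->//|vw] := eqVneq v w.
  move: s0; rewrite cw scale0r add0r => s0.
  apply: (iB (rem w s) c) => //; first exact: rem_uniq.
  by rewrite mem_rem_uniq // inE vw.
exists B; split; first by move=> v Bv; have [] := wB v Bv; split=> //; apply: B0.
split=> [v|s f us Mf s0].
  split=> [/US[s [c [us Bs ->]]]|[s [f [us Mf ->]]]]; last first.
    apply: subspace_sum => // j /Mf[c _ <-]; apply: subspaceZ => //.
    by apply: (wB _ _).1; apply: set_mem (valP j).
  exists (pmap insub s), (fun j => c (val j) *: val j); split.
  - exact: pmap_sub_uniq.
  - by move=> j _; exists (c (val j)).
  rewrite -(big_map val predT (fun w => c w *: w)) pmap_filter; last exact: insubK.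
  rewrite (_ : seq.filter _ s = s) //; apply/all_filterP/allP => w ws /=.
  by rewrite isSome_insub; apply/mem_set/Bs.
have /choice[c cE] : forall j, exists c : C, j \in s -> f j = c *: val j.
  move=> j; have [js|js] := boolP (j \in s); last by exists 0.
  by have [c _ <-] := Mf j js; exists c.
pose k (w : V) : C := if insub w is Some j then c j else 0.
have kE j : k (val j) = c j by rewrite /k valK.
have k0 := iB (map val s) k _ _ _ _.
move=> j js; rewrite cE // -kE k0 ?scale0r //.
- by rewrite map_inj_uniq //; apply: val_inj.
- by move=> _ /mapP[i is_ ->]; apply: set_mem (valP i).
- rewrite big_map -[RHS]s0; apply: eq_big_seq => i is_ /=.
  by rewrite kE cE.
by rewrite map_f.
Qed.

End Weights.

(** * Loop root vectors acting on weight vectors *)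

Section LoopAction.
Variables (C : numClosedFieldType) (g : finLieAlgType C) (h : {vspace g}).
Variables (V : lmodType C) (rho : lie_action (loope g) V).
Implicit Types (x y : g) (z : subvs_of h) (l : ewt h).

Lemma monoZ (a : C) x k : mono (a *: x) k = a *: mono x k.
Proof. by apply: loopP => m; rewrite loopZE !monoE; case: eqP; rewrite ?scaler0. Qed.

Lemma monoD x y k : mono (x + y) k = mono x k + mono y k.
Proof. by apply: loopP => m; rewrite loopDE !monoE; case: eqP; rewrite ?addr0. Qed.

Lemma act_mono_linear k v : linear (fun x => rho (mono x k, 0) v).
Proof.
move=> a x y; rewrite -act_linearl; congr (rho _ v); congr pair.
  by rewrite monoD monoZ.
by rewrite /= scaler0 addr0.
Qed.

Lemma act_mono_lie x y k m v :
  rho (mono x k, 0) (rho (mono y m, 0) v) - rho (mono y m, 0) (rho (mono x k, 0) v)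
  = rho (mono [lie x, y] (k + m), 0) v.
Proof.
rewrite -act_lie; congr (rho _ v); congr pair.
by rewrite /= !scale0r addr0 subr0 lie_mono.
Qed.

Lemma weight_space_shift (b : cdual h) x l k v : root_space b x ->
  weight_space rho l v ->
  weight_space rho (l.1 + b, l.2 + k%:~R) (rho (mono x k, 0) v).
Proof.
move=> bx lv z a.
have /eqP := act_lie rho (mono (vsval z) 0, a) (mono x k, 0) v.
rewrite eq_sym subr_eq lv (linZ (act_linearr rho _)) => /eqP->.
have -> : [lie ((mono (vsval z) 0, a) : loope g), ((mono x k, 0) : loope g)] =
    (b z + k%:~R * a : C) *: ((mono x k, 0) : loope g).
  congr pair; last by rewrite /= scaler0.
  rewrite /= scale0r subr0 lie_mono bx add0r monoZ loop_der_mono scalerA.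
  by rewrite -scalerDl [a * _]mulrC.
rewrite (linZ (act_linearl rho v)) -scalerDl add_lfunE /=; congr (_ *: _); ring.
Qed.

Lemma weight_space_shift_iter (b : cdual h) x l k v m : root_space b x ->
  weight_space rho l v ->
  weight_space rho (l.1 + b *+ m, l.2 + k%:~R *+ m) (iter m (rho (mono x k, 0)) v).
Proof.
move=> bx lv; elim: m => [|m IH]; first by rewrite !mulr0n !addr0 -surjective_pairing.
by rewrite iterS !mulrS 2![_ + (_ *+ m)]addrC !addrA; apply: weight_space_shift IH.
Qed.

(** The elements x t^(-k), y t^k and z form an sl2-triple for every k, since the
    bracket of L^e(g) has no central term. *)
Lemma loop_lowest_weight (b : cdual h) x y z l k v :
  root_space b x -> [lie x, y] = vsval z -> b z = 2 ->
  locally_nilpotent (rho (mono x (- k), 0)) ->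
  weight_space rho l v -> v != 0 -> rho (mono y k, 0) v = 0 ->
  exists m : nat, l.1 z = - m%:R.
Proof.
move=> bx xy bz nx lv v0 yv.
have zv : rho (mono (vsval z) 0, 0) v = l.1 z *: v.
  by rewrite lv mulr0 addr0.
have [||u|u||m] := @lowest_weight C V (rho (mono x (- k), 0)) (rho (mono y k, 0))
  (rho (mono (vsval z) 0, 0)) 2 _ _ _ _ v (l.1 z) v0 yv zv.
- exact: act_linearr.
- exact: act_linearr.
- by rewrite act_mono_lie xy addNr.
- by rewrite act_mono_lie add0r bx bz (linZ (act_mono_linear _ _)).
- exact: nx.
move=> e2; exists m; apply: (mulIf (_ : 2 != 0 :> C)); first by rewrite pnatr_eq0.
by rewrite mulr_natr e2 mulNr -[2 *+ m]mulr_natl.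
Qed.

(** Weights of an integrable module take integral values on coroots. *)
Lemma loop_weight_int (b : cdual h) x y z l v :
  root_space b x -> root_space (- b) y -> [lie x, y] = vsval z -> b z = 2 ->
  (forall k, locally_nilpotent (rho (mono x k, 0))) ->
  (forall k, locally_nilpotent (rho (mono y k, 0))) ->
  weight_space rho l v -> v != 0 -> exists m : int, l.1 z = m%:~R.
Proof.
move=> bx by_ xy bz nx ny lv v0.
have Emin : exists k, iter k (rho (mono y 0, 0)) v == 0.
  by have [k yk] := ny 0 v; exists k; apply/eqP.
case: (ex_minnP Emin) => -[|k] /eqP yk kmin; first by rewrite [v]yk eqxx in v0.
have w0 : iter k (rho (mono y 0, 0)) v != 0.
  by apply/negP => /kmin; rewrite ltnn.
have lw := weight_space_shift_iter 0 k by_ lv.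
have [//|m] := loop_lowest_weight (k := 0) bx xy bz _ lw w0 yk.
rewrite add_lfunE cdualMn opp_lfunE bz /= => /eqP.
rewrite -subr_eq0 mulNrn -addrA -opprD subr_eq0 => /eqP ->.
by exists (k.*2%:Z - m%:Z); rewrite intrB -[2 *+ k]mulrnA -muln2 mulnC.
Qed.

End LoopAction.

(** * Small weights of nontrivial submodules *)

Section Nontrivial.
Variables (C : numClosedFieldType) (g : finLieAlgType C) (h : {vspace g}).
Hypotheses (hg : simple_lie g) (hh : cartan h).
Variables (n : nat) (e : n.-tuple g) (eps : 'I_n -> cdual h).
Hypotheses (ebasis : basis_of fullv e).
Hypothesis (eweight : forall i, root_space (eps i) e`_i).
Variables (V : lmodType C) (rho : lie_action (loope g) V).
Hypothesis wdec : direct_sum setT (weight_space (h := h) rho) setT.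
Hypothesis wint : forall (l : ewt h) v, weight_space rho l v -> v != 0 ->
  exists k : int, l.2 = k%:~R.
(* X i, Y i, H i is an sl2-triple for the root eps i, whose loops X i t^k and
   Y i t^k act locally nilpotently; nothing is assumed when eps i = 0. *)
Variables (X Y : 'I_n -> g) (H : 'I_n -> subvs_of h).
Hypothesis triple : forall i, eps i != 0 ->
  [/\ X i != 0, root_space (eps i) (X i), root_space (- eps i) (Y i),
      [lie X i, Y i] = vsval (H i) & eps i (H i) = 2].
Hypothesis nilp : forall i, eps i != 0 -> forall k,
  locally_nilpotent (rho (mono (X i) k, 0)) /\
  locally_nilpotent (rho (mono (Y i) k, 0)).
Implicit Types (M : set V) (l : ewt h) (v : V).

Lemma triples_exist i : eps i != 0 -> exists x y,
  [/\ x != 0, root_space (eps i) x, root_space (- eps i) y,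
      [lie x, y] = vsval (H i) & eps i (H i) = 2].
Proof. by move=> /triple[]; exists (X i), (Y i). Qed.

Lemma weight_int i l v : eps i != 0 -> weight_space rho l v -> v != 0 ->
  exists m : int, l.1 (H i) = m%:~R.
Proof.
move=> i0 lv v0; have [_ ix iy xy iz] := triple i0.
by apply: (loop_weight_int ix iy xy iz _ _ lv v0) => k; have [] := nilp i0 k.
Qed.

Lemma lower_neq0 i l v k (m : int) : eps i != 0 -> weight_space rho l v ->
  v != 0 -> l.1 (H i) = m%:~R -> 0 < m -> rho (mono (Y i) k, 0) v != 0.
Proof.
move=> i0 lv v0 lm m0; have [_ ix iy xy iz] := triple i0.
apply/negP => /eqP yv.
have [|p] := loop_lowest_weight ix xy iz _ lv v0 yv; first exact: (nilp i0 _).1.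
rewrite lm => /eqP; rewrite pmulrn -mulrNz eqr_int => /eqP mp.
by rewrite mp oppr_gt0 in m0.
Qed.

Lemma raise_neq0 i l v k (m : int) : eps i != 0 -> weight_space rho l v ->
  v != 0 -> l.1 (H i) = m%:~R -> m < 0 -> rho (mono (X i) k, 0) v != 0.
Proof.
move=> i0 lv v0 lm m0; have [_ ix iy xy iz] := triple i0.
apply/negP => /eqP xv.
have yx : [lie Y i, X i] = vsval (- H i) by rewrite lieC xy linearN.
have iz' : (- eps i) (- H i) = 2 by rewrite opp_lfunE linearN /= opprK.
have [|p] := loop_lowest_weight iy yx iz' _ lv v0 xv; first exact: (nilp i0 _).2.
rewrite linearN /= lm => /oppr_inj/eqP; rewrite pmulrn eqr_int => /eqP mp.
by rewrite mp ltNge in m0.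
Qed.

Lemma submodule_subspace M : submodule rho M -> subspace M.
Proof. by case. Qed.

Lemma submodule_stable M : submodule rho M -> he_stable h rho M.
Proof. by move=> [_ _ stM] z a u; apply: stM. Qed.

(** Otherwise root vectors kill M, and the set J of those x in g such that all
    x t^k kill M is a nonzero ideal of g. *)
Lemma nontrivial_weight M : submodule rho M ->
  ~ M `<=` annihilated rho (@Lg _ g) ->
  exists l v, [/\ M v, v != 0, weight_space rho l v & l.1 != 0].
Proof.
move=> sM ntM; case: (pselect (exists l v,
  [/\ M v, v != 0, weight_space rho l v & l.1 != 0]))
  => // nex; exfalso; apply: ntM.
have M0 l v : M v -> weight_space rho l v -> l.1 != 0 -> v = 0.
  move=> Mv lv l0; apply/eqP; apply: contraPT isT => v0.
  by case: nex; exists l, v.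
have [_ _ stM] := sM.
pose J : set g := [set x | forall k v, M v -> rho (mono x k, 0) v = 0].
have sJ : subspace J.
  split=> [k v Mv|a x y Jx Jy k v Mv]; first exact: (lin0 (act_mono_linear rho k v)).
  by rewrite (act_mono_linear rho k v) Jx // Jy // scaler0 addr0.
have Jroot b x : b != 0 -> root_space (b : cdual h) x -> J x.
  move=> b0 bx k; pose A : set V := [set v | rho (mono x k, 0) v = 0].
  have sA : subspace A.
    split=> [|a u v Au Av] /=; first exact: (lin0 (act_linearr rho _)).
    by rewrite /A /= act_linearr Au Av scaler0 addr0.
  apply: (stable_spanned wdec (submodule_subspace sM) (submodule_stable sM) sA).
  move=> l v Mv lv; have [l0|l0] := eqVneq l.1 0; last first.
    by rewrite /A /= (M0 l v) // (lin0 (act_linearr rho _)).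
  have := weight_space_shift k bx lv; rewrite l0 add0r => /M0; apply=> //.
  exact: stM.
have Jideal x y : J y -> J [lie x, y].
  move=> Jy k v Mv; rewrite -[k]add0r -act_mono_lie Jy //.
  by rewrite (lin0 (act_linearr rho _)) sub0r Jy ?oppr0 //; apply: stM.
have Jall y : J y.
  move: y; have [J0|//] := simple_ideal hg sJ Jideal.
  have [b [x [y [z [b0 bx _ xy z0]]]]] := exists_bracket hg hh ebasis eweight.
  exfalso; move/eqP: z0; apply; apply/val_inj.
  by rewrite /= -xy (J0 x) ?lie0r //; apply: Jroot bx.
move=> v Mv [f a] fa; have -> : a = 0 by exact: fa.
have -> : ((f, 0) : loope g) = \sum_(i <- loop_supp f) ((mono (f i) i, 0) : loope g).
  rewrite {1}[f]loop_decomp; elim: (loop_supp f) => [|i s IH];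
    first by rewrite !big_nil.
  by rewrite !big_cons -IH; congr pair; rewrite /= addr0.
by rewrite (lin_sum (act_linearl rho v)) big1 // => i _; apply: Jall.
Qed.

(** Weights with values -1, 0 or 1 on all coroots. *)
Definition small_weight (mu : cdual h) :=
  forall i, eps i != 0 -> exists2 m : int, -1 <= m <= 1 & mu (H i) = m%:~R.

(** Every nontrivial submodule has a small weight of degree 0. From a weight of
    degree s on which a coroot H i is positive, Y i t^(-s) leads to degree 0,
    and within degree 0 the norm decreases as long as some |mu (H i)| >= 2. *)
Lemma nontrivial_small_weight M : submodule rho M ->
  ~ M `<=` annihilated rho (@Lg _ g) ->
  exists mu v, [/\ small_weight mu, M v, v != 0 & weight_space rho (mu, 0) v].
Proof.
move=> sM ntM; have [_ _ stM] := sM.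
have [l [v [Mv v0 lv l0]]] := nontrivial_weight sM ntM.
pose W : set (cdual h) :=
  [set mu | exists v, [/\ M v, v != 0 & weight_space rho (mu, 0) v]].
(* The degree of the loop vector is chosen so as to land in degree 0. *)
have lowerW mu s u i (m : int) : M u -> u != 0 -> weight_space rho (mu, s) u ->
    eps i != 0 -> mu (H i) = m%:~R -> 0 < m -> W (mu - eps i).
  move=> Mu u0 lu i0 mi m0; have [k sk] := wint lu u0.
  have [_ ix iy xy iz] := triple i0.
  exists (rho (mono (Y i) (- k), 0) u); split.
  - exact: stM.
  - exact: lower_neq0 i0 lu u0 mi m0.
  by have := weight_space_shift (- k) iy lu; rewrite /= [s]sk intrN subrr.
have raiseW mu s u i (m : int) : M u -> u != 0 -> weight_space rho (mu, s) u ->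
    eps i != 0 -> mu (H i) = m%:~R -> m < 0 -> W (mu + eps i).
  move=> Mu u0 lu i0 mi m0; have [k sk] := wint lu u0.
  have [_ ix iy xy iz] := triple i0.
  exists (rho (mono (X i) (- k), 0) u); split.
  - exact: stM.
  - exact: raise_neq0 i0 lu u0 mi m0.
  by have := weight_space_shift (- k) ix lu; rewrite /= [s]sk intrN subrr.
have W0 : W !=set0.
  have [[i [i0 li]]|nex] := pselect (exists i, eps i != 0 /\ l.1 (H i) != 0);
    last first.
    case/eqP: l0; apply: (coroots_span hg hh ebasis eweight triples_exist) => i i0.
    by apply/eqP; apply: contraPT isT => li; case: nex; exists i.
  have [m lm] := weight_int i0 lv v0.
  have lv' : weight_space rho (l.1, l.2) v by rewrite -surjective_pairing.
  have [m0|m0|m0] := ltrgt0P m.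
  - by exists (l.1 - eps i); apply: (lowerW l.1 l.2 v i m).
  - by exists (l.1 + eps i); apply: (raiseW l.1 l.2 v i m).
  by rewrite lm m0 eqxx in li.
have Wint mu : W mu -> forall i, eps i != 0 -> exists m : int, mu (H i) = m%:~R.
  by move=> [u [Mu u0 lu]] i i0; apply: (weight_int i0 lu u0).
have [mu Wmu mumin] := form_descent hg hh ebasis eweight triples_exist W0 Wint.
have [u [Mu u0 lu]] := Wmu; exists mu, u; split=> // i i0.
have [m im] := Wint _ Wmu i i0; exists m => //.
have [lo hi] := mumin i m i0 im.
apply/andP; split; rewrite leNgt; apply/negP => mlt.
  apply: hi; first by rewrite -ltzD1.
  by apply: (raiseW mu 0 u i m) => //; apply: lt_trans mlt _.
apply: lo; first by rewrite -[2]/(1 + 1) lez1D.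
by apply: (lowerW mu 0 u i m) => //; apply: lt_trans mlt.
Qed.

Lemma small_weights_finite : exists S : seq (cdual h),
  forall mu, small_weight mu -> mu \in S.
Proof.
(* f i - 1 is the value on H i; a weight is determined by these values. *)
pose code (mu : cdual h) (f : {ffun 'I_n -> 'I_3}) :=
  forall i, eps i != 0 -> mu (H i) = (f i)%:R - 1.
have /choice[w wP] : forall f, exists mu, forall mu', code mu' f -> mu' = mu.
  move=> f; have [[mu cmu]|nex] := pselect (exists mu, code mu f); last first.
    by exists 0 => mu' c'; case: nex; exists mu'.
  exists mu => mu' c'; apply/eqP; rewrite -subr_eq0; apply/eqP.
  apply: (coroots_span hg hh ebasis eweight triples_exist) => i i0.
  by rewrite add_lfunE opp_lfunE cmu // c' // subrr.
exists [seq w f | f <- enum {ffun 'I_n -> 'I_3}] => mu smu.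
have /choice[f fE] : forall i, exists j : 'I_3, eps i != 0 -> mu (H i) = j%:R - 1.
  move=> i; have [i0|i0] := eqVneq (eps i) 0; first by exists ord0.
  have [m mlt ->] := smu i i0.
  have m3 : (`|(m + 1)%R| < 3)%N.
    by move: mlt; case: m => [[|[|]]|[|]].
  exists (Ordinal m3) => _ /=; rewrite pmulrn gez0_abs ?intrD ?addrK //.
  by case/andP: mlt; rewrite -lerBlDr sub0r.
rewrite (wP [ffun i => f i] mu); first by rewrite map_f ?mem_enum.
by move=> i i0; rewrite ffunE fE.
Qed.

End Nontrivial.

(** * Splitting off invariants and decomposing the rest *)

Section Decomposition.
Variables (C : numClosedFieldType) (g : finLieAlgType C) (h : {vspace g}).
Variables (V : lmodType C) (rho : lie_action (loope g) V).
Implicit Types (U A B M : set V) (l : ewt h) (v : V).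

(** The submodule of vectors killed by L(g). *)
Definition invariants : set V := annihilated rho (@Lg _ g).

(** The span of the u m, for u in L(g) and m in M, as the least subspace that
    contains them. *)
Definition loop_image M : set V :=
  [set v | forall U, subspace U -> (forall u m, Lg u -> M m -> U (rho u m)) -> U v].

Lemma loop_image_subspace M : subspace (loop_image M).
Proof.
split=> [U sU _|a u v Qu Qv U sU UM]; first exact: sU.1.
by apply: sU.2; [apply: Qu|apply: Qv].
Qed.

Lemma invariants_subspace : subspace invariants.
Proof.
split=> [u _|a u v Ku Kv w Lw]; first exact: (lin0 (act_linearr rho u)).
by rewrite act_linearr Ku // Kv // scaler0 addr0.
Qed.

Lemma Lg_lie (u x : loope g) : Lg [lie u, x]. Proof. by []. Qed.

Lemma invariants_submodule : submodule rho invariants.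
Proof.
have [K0 KD] := invariants_subspace; split=> // x v Kv u Lu.
have /eqP := act_lie rho u x v; rewrite Kv; last exact: Lg_lie.
by rewrite (Kv u) // (lin0 (act_linearr rho x)) subr0 eq_sym => /eqP.
Qed.

Lemma loop_image_submodule M : submodule rho M -> submodule rho (loop_image M).
Proof.
move=> [_ _ stM]; have [Q0 QD] := loop_image_subspace M; split=> // x v Qv.
pose W : set V := [set v | loop_image M (rho x v)].
have sW : subspace W.
  split=> [|a u w Wu Ww].
    exact: (@eq_ind_r _ _ (loop_image M) Q0 _ (lin0 (act_linearr rho x))).
  exact: (@eq_ind_r _ _ (loop_image M) (QD a _ _ Wu Ww) _ (act_linearr rho x a u w)).
apply: (Qv W sW) => u m Lu Mm.
have /eqP := act_lie rho x u m; rewrite eq_sym subr_eq => /eqP e.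
suff : loop_image M (rho x (rho u m)) by [].
rewrite e; apply: (subspaceD (loop_image_subspace M)).
  by move=> U sU UM; apply: UM => //; apply: Lg_lie.
by move=> U sU UM; apply: UM => //; apply: stM.
Qed.

Lemma submodule_of_stable M : subspace M -> he_stable h rho M ->
  (forall u m, Lg u -> M m -> M (rho u m)) -> submodule rho M.
Proof.
move=> sM hM LM; split; [exact: sM.1|exact: sM.2|move=> [f a] m Mm].
have -> : ((f, a) : loope g) = (f, 0) + (mono (vsval (0 : subvs_of h)) 0, a).
  congr pair; rewrite /= ?add0r //.
  by rewrite [X in f + X](_ : _ = 0) ?addr0 //; apply: loopP => k; rewrite monoE;
    case: ifP.
rewrite (linD (act_linearl rho m)); apply: subspaceD => //; first exact: LM.
exact: hM.
Qed.

(** Submodules M whose invariant vectors all lie in L(g) M. This prevents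
    nonzero trivial direct summands, and unlike that property it passes at once
    to direct summands. *)
Definition essential M :=
  submodule rho M /\ forall v, M v -> invariants v -> loop_image M v.

Lemma direct_sum2C A B M : direct_sum2 A B M -> direct_sum2 B A M.
Proof.
move=> [e i]; split; last by rewrite setIC.
rewrite -e; apply/seteqP; split=> _ [a Aa [b Bb <-]].
  by exists b => //; exists a; rewrite // addrC.
by exists b => //; exists a; rewrite // addrC.
Qed.

Lemma summand_subset A B M : subspace B -> direct_sum2 A B M -> A `<=` M.
Proof.
move=> sB [<- _] a Aa; apply/sum_setE; exists a, 0.
by rewrite addr0; split=> //; apply: sB.1.
Qed.

Lemma essential_summand A B M : submodule rho A -> submodule rho B ->
  direct_sum2 A B M -> essential M -> essential A.
Proof.
move=> mA mB dM [mM eM]; split=> // v Av Kv.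
have sA := submodule_subspace mA; have sB := submodule_subspace mB.
have := eM v (summand_subset sB dM Av) Kv.
move=> /(_ (sum_set (loop_image A) (loop_image B))).
have [eAB dAB] := (direct_sum2E _ sA sB).1 dM.
have QA U : submodule rho U -> loop_image U `<=` U.
  move=> mU w Qw; apply: (Qw U (submodule_subspace mU)) => u m _ Um.
  by have [_ _ stU] := mU; apply: stU.
case.
- by apply: subspace_sum_set; apply: loop_image_subspace.
- move=> u m Lu; rewrite -{1}eAB => /sum_setE[a [b [Aa Bb ->]]].
  rewrite (linD (act_linearr rho u)); apply/sum_setE.
  exists (rho u a), (rho u b); split=> // U sU UM; exact: UM.
move=> a Qa [b Qb e].
have [<- _] := direct_uniq sA sB dAB (QA _ mA _ Qa) Av (QA _ mB _ Qb) sB.1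
  (etrans e (esym (addr0 v))).
by [].
Qed.

Lemma essential_trivial M : essential M -> M `<=` invariants -> M `<=` [set 0].
Proof.
move=> [_ eM] MK v Mv; apply: (eM v Mv (MK v Mv)); first exact: subspace0.
by move=> u m Lu /MK /(_ u Lu).
Qed.

Lemma seq_direct_void : seq_direct (fun _ : 'I_0 => [set 0]) [set (0 : V)].
Proof.
split=> [v|s f _ _ _ []//]; split=> [->|[s [f [_ _ ->]]]].
  by exists [::], (fun _ => 0); rewrite big_nil.
by rewrite /= big1 // => -[].
Qed.

Lemma seq_direct_single M : subspace M -> seq_direct (fun _ : 'I_1 => M) M.
Proof.
move=> sM; split=> [v|s f us Mf s0 j js].
  split=> [Mv|[s [f [us Mf ->]]]]; last exact: subspace_sum.
  by exists [:: ord0], (fun _ => v); rewrite big_seq1.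
rewrite -[RHS]s0 (bigD1_seq j) //= big1 ?addr0 // => k.
by rewrite !ord1.
Qed.

Lemma summand_proper M : submodule rho M -> M <> [set 0] -> ~ indecomposable rho M ->
  exists A B, [/\ submodule rho A, submodule rho B, direct_sum2 A B M,
    A <> [set 0] & B <> [set 0]].
Proof.
move=> mM M0 nM; case: (pselect (exists A B, [/\ submodule rho A,
  submodule rho B, direct_sum2 A B M, A <> [set 0] & B <> [set 0]])) => // nex.
exfalso; apply: nM; split=> // A B mA mB dM.
case: (pselect (A = [set 0])) => A0; first by left.
case: (pselect (B = [set 0])) => B0; first by right.
by case: nex; exists A, B.
Qed.

Hypothesis fin : forall l, fin_dim (weight_space rho l).
Variable S : seq (ewt h).
Hypothesis meets : forall M, submodule rho M -> ~ M `<=` invariants ->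
  exists l v, [/\ l \in S, M v, v != 0 & weight_space rho l v].

(** Every nonzero summand of an essential M is nontrivial, so it meets the span
    of the weight spaces of weights in S. That span is finite dimensional, so
    dimension_measure drops strictly when passing to a proper summand. *)
Lemma essential_decomposition M : essential M ->
  exists n (N : 'I_n -> set V),
    (forall i, indecomposable rho (N i)) /\ seq_direct N M.
Proof.
have [N [b bP]] := fin_dim_span (fun l _ => fin l) (S := S).
have [d dP] := dimension_measure b.
have [k] := ubnP (d M); elim: k M => // k IH M dM eM; have mM := eM.1.
have [->|M0] := pselect (M = [set 0]).
  by exists 0%N, (fun _ => [set 0]); split; [case|exact: seq_direct_void].
have [iM|/(summand_proper mM M0)] := pselect (indecomposable rho M).
  exists 1%N, (fun _ => M); split=> //.
  exact/seq_direct_single/(submodule_subspace mM).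
move=> [A [B [mA mB dAB A0 B0]]].
have smaller A' B' : submodule rho A' -> submodule rho B' ->
    direct_sum2 A' B' M -> B' <> [set 0] -> (d A' < k)%N.
  move=> mA' mB' dM' B'0; rewrite ltnS in dM; apply: leq_trans dM.
  have sA' := submodule_subspace mA'; have sB' := submodule_subspace mB'.
  apply: dP => //; first exact: (submodule_subspace mM).
    exact: summand_subset sB' dM'.
  have eB' := essential_summand mB' mA' (direct_sum2C dM') eM.
  have [|l [v [lS Bv v0 lv]]] := meets mB'.
    move=> /(essential_trivial eB') B'sub; apply: B'0; apply/seteqP; split=> // _ ->.
    exact: sB'.1.
  have [c vc] := bP l lS v lv; exists c; rewrite -vc; split.
    exact: (summand_subset sA' (direct_sum2C dM')).
  move=> Av; have [_ dis] := (direct_sum2E _ sA' sB').1 dM'.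
  by move/eqP: v0; apply; apply: dis.
have eA := essential_summand mA mB dAB eM.
have eB := essential_summand mB mA (direct_sum2C dAB) eM.
have [nA [NA [iA sA]]] := IH A (smaller A B mA mB dAB B0) eA.
have [nB [NB [iB sB]]] := IH B (smaller B A mB mA (direct_sum2C dAB) A0) eB.
exists (nA + nB)%N, (sum_family NA NB \o @fintype.split nA nB); split.
  by move=> i /=; case: (fintype.split i).
apply: seq_direct_bij; first by exists (@unsplit nA nB);
  [apply: splitK|apply: unsplitK].
exact: seq_direct_sum (submodule_subspace mA) (submodule_subspace mB) dAB sA sB.
Qed.

Hypothesis wdec : direct_sum setT (weight_space (h := h) rho) setT.

(** Let K be the invariants and Q = L(g) V. Choose h_e-stable complements: first
    D of K `&` Q, so that T = K `&` D is a complement of K `&` Q in K, and then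
    U of T, containing Q. Any h_e-stable subspace that lies in K or contains Q
    is a submodule, and the invariants in U lie in Q = L(g) U. *)
Lemma invariant_splitting : exists U1 U2, [/\ submodule rho U1,
  submodule rho U2, direct_sum2 U1 U2 setT, U1 `<=` invariants & essential U2].
Proof.
have mT : submodule rho setT by [].
have mQ := loop_image_submodule mT; have mK := invariants_submodule.
set Q := loop_image setT in mQ *.
have sQ := submodule_subspace mQ; have sK := submodule_subspace mK.
have hQ := @submodule_stable _ _ h _ _ _ mQ.
have hK := @submodule_stable _ _ h _ _ _ mK.
have sKQ := subspaceI sK sQ.
have hKQ : he_stable h rho (invariants `&` Q).
  by move=> z a u [Ku Qu]; split; [apply: hK|apply: hQ].
have [||D [sD hD _ KQD KQDT]] := stable_complement wdec sKQ hKQ (subspace0 V).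
- by move=> z a _ ->; apply: (lin0 (act_linearr rho _)).
- by move=> v _ ->.
pose T := invariants `&` D.
have sT : subspace T by apply: subspaceI.
have hT : he_stable h rho T.
  by move=> z a u [Ku Du]; split; [apply: hK|apply: hD].
have [|U [sU hU QU TU TUT]] := stable_complement wdec sT hT sQ hQ.
  by move=> v [Kv Dv] Qv; apply: KQD.
have TK : T `<=` invariants by move=> v [].
have LQ u m : Lg u -> Q (rho u m) by move=> Lu W sW; apply.
have mTT : submodule rho T.
  apply: submodule_of_stable => // u m Lu [Km _].
  by rewrite Km //; apply: sT.1.
have mU : submodule rho U.
  by apply: submodule_of_stable => // u m Lu _; apply: (QU _ (LQ u m Lu)).
have dTU : direct_sum2 T U setT by apply/direct_sum2E.
have QUE v : Q v -> loop_image U v.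
  apply; first exact: loop_image_subspace.
  move=> u m Lu _; have : (sum_set T U) m by rewrite TUT.
  move=> /sum_setE[t [w [/TK Kt Uw ->]]].
  rewrite (linD (act_linearr rho u)) Kt // add0r => W sW; exact.
exists T, U; split=> //; split=> // v Uv Kv; apply: QUE.
have : (sum_set (invariants `&` Q) D) v by rewrite KQDT.
move=> /sum_setE[q [t [[Kq Qq] Dt e]]].
have Kt : invariants t.
  by apply: (@subspaceDr _ _ invariants q) => //; rewrite -e.
have Ut : U t by apply: (@subspaceDr _ _ U q) => //; [apply: QU|rewrite -e].
by rewrite e (TU t) ?addr0.
Qed.

Lemma line_indecomposable v : v != 0 -> submodule rho [set c *: v | c in setT] ->
  indecomposable rho [set c *: v | c in setT].
Proof.
move=> v0 mL; split=> //.
  move=> L0; have : [set c *: v | c in setT] (1 *: v) by exists 1.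
  by rewrite L0 /= scale1r => /eqP; rewrite (negbTE v0).
move=> A B mA mB dAB; case: (pselect (A = [set 0])) => [|A0]; [by left|right].
have sA := submodule_subspace mA; have sB := submodule_subspace mB.
have [a [Aa a0]] : exists a, A a /\ a != 0.
  case: (pselect (exists a, A a /\ a != 0)) => // nex; exfalso; apply: A0.
  apply/seteqP; split=> [a Aa|_ ->]; last exact: sA.1.
  by apply/eqP; apply: contraPT isT => a0; case: nex; exists a.
have [_ dis] := (direct_sum2E _ sA sB).1 dAB.
have [c _ ca] := summand_subset sB dAB Aa.
have Av : A v.
  have c0 : c != 0 by apply: contra_neq a0 => c0; rewrite -ca c0 scale0r.
  have -> : v = c^-1 *: a by rewrite -ca scalerA mulVf ?scale1r.
  exact: subspaceZ.
apply/seteqP; split=> [b Bb|_ ->]; last exact: sB.1.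
apply: dis => //; have [k _ <-] := summand_subset sA (direct_sum2C dAB) Bb.
exact: subspaceZ.
Qed.

Lemma invariant_line v l : invariants v -> weight_space rho l v ->
  submodule rho [set c *: v | c in setT].
Proof.
move=> Kv lv; apply: submodule_of_stable.
- split=> [|a _ _ [c _ <-] [d _ <-]]; first by exists 0; rewrite ?scale0r.
  by exists (a * c + d); rewrite // scalerDl scalerA.
- move=> z a _ [c _ <-]; exists (c * (l.1 z + l.2 * a)) => //.
  by rewrite (linZ (act_linearr rho _)) lv scalerA.
move=> u _ Lu [c _ <-]; exists 0; rewrite // scale0r.
by rewrite (linZ (act_linearr rho u)) Kv // scaler0.
Qed.

Lemma invariants_decomposition U : submodule rho U -> U `<=` invariants ->
  exists (J : choiceType) (M : J -> set V),
    (forall j, indecomposable rho (M j)) /\ seq_direct M U.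
Proof.
move=> mU UK.
have [B [BP dB]] := line_decomposition wdec (submodule_subspace mU)
  (@submodule_stable _ _ h _ _ _ mU).
exists {v : V | v \in B}, (fun j => [set c *: val j | c in setT]); split=> // j.
have [j0 Uj [l lj]] := BP _ (set_mem (valP j)).
by apply: line_indecomposable => //; apply: invariant_line lj; apply: UK.
Qed.

(** A complement of a trivial submodule contains all weight spaces of weights
    that do not vanish on h, since h acts by zero on the trivial part. *)
Lemma weight_vector_summand U1 U2 l : submodule rho U1 -> submodule rho U2 ->
  direct_sum2 U1 U2 setT -> U1 `<=` invariants -> l.1 != 0 ->
  weight_space rho l `<=` U2.
Proof.
move=> m1 m2 d12 U1K l0 v lv.
have s1 := submodule_subspace m1; have s2 := submodule_subspace m2.
have [e dis] := (direct_sum2E _ s1 s2).1 d12.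
have : sum_set U1 U2 v by rewrite e.
move=> /sum_setE[v1 [v2 [U1v U2v ev]]].
have [z lz] := cdual_neq l0; rewrite zero_lfunE in lz.
suff v10 : v1 = 0 by rewrite ev v10 add0r.
have := lv z 0; rewrite mulr0 addr0 {1}ev (linD (act_linearr rho _)) U1K //.
rewrite ev scalerDr => e2.
have [||||/esym/eqP + _] := direct_uniq s1 s2 dis _ _ _ _ e2.
- exact: s1.1.
- exact: subspaceZ.
- by have [_ _ st2] := m2; apply: st2.
- exact: subspaceZ.
by rewrite scaler_eq0 (negbTE lz) => /eqP.
Qed.

End Decomposition.

(** * Integrable triples *)

Lemma scaled_nilpotent (C : numClosedFieldType) (V : lmodType C) (f : V ->
  V) (a : C) :
  linear f -> locally_nilpotent f -> locally_nilpotent (fun v => a *: f v).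
Proof.
move=> lf nf v; have [m fm] := nf v; exists m.
suff -> : iter m (fun v => a *: f v) v = a ^+ m *: iter m f v by rewrite fm scaler0.
elim: m {fm} => [|m IH]; first by rewrite scale1r.
by rewrite !iterS IH (linZ lf) scalerA exprS.
Qed.

Section Triples.
Variables (C : numClosedFieldType) (g : finLieAlgType C) (h : {vspace g}).
Hypotheses (hg : simple_lie g) (hh : cartan h).
Variables (n : nat) (e : n.-tuple g) (eps : 'I_n -> cdual h).
Hypotheses (ebasis : basis_of fullv e).
Hypothesis (eweight : forall i, root_space (eps i) e`_i).
Variables (I : finType) (alpha : I -> cdual h) (halpha : simple_roots alpha).
Variables (xp xm : cdual h -> g) (hx : root_vectors alpha xp xm).
Variables (V : lmodType C) (rho : lie_action (loope g) V).
Hypothesis intV : integrable alpha rho xp xm.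

(** For every root, positive or negative, rescaling the given root vectors
    yields an sl2-triple whose loops act locally nilpotently. *)
Lemma integrable_triples : exists (X Y : 'I_n -> g) (H : 'I_n -> subvs_of h),
  forall i, eps i != 0 ->
  [/\ X i != 0, root_space (eps i) (X i), root_space (- eps i) (Y i),
      [lie X i, Y i] = vsval (H i) & eps i (H i) = 2] /\
  forall k, locally_nilpotent (rho (mono (X i) k, 0)) /\
    locally_nilpotent (rho (mono (Y i) k, 0)).
Proof.
suff /choice[t tP] : forall i, exists t : g * g * subvs_of h, eps i != 0 ->
    [/\ t.1.1 != 0, root_space (eps i) t.1.1, root_space (- eps i) t.1.2,
      [lie t.1.1, t.1.2] = vsval t.2 & eps i t.2 = 2] /\
    forall k, locally_nilpotent (rho (mono t.1.1 k, 0)) /\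
      locally_nilpotent (rho (mono t.1.2 k, 0)).
  by exists (fun i => (t i).1.1), (fun i => (t i).1.2), (fun i => (t i).2).
move=> i; have [i0|i0] := eqVneq (eps i) 0; first by exists (0, 0, 0).
suff [x [y [[ix x0] [iy y0] nxy]]] : exists x y,
    [/\ root_space (eps i) x /\ x != 0, root_space (- eps i) y /\ y != 0 &
      forall k, locally_nilpotent (rho (mono x k, 0)) /\
        locally_nilpotent (rho (mono y k, 0))].
  have [a [z [xy iz]]] := sl2_triple hg hh ebasis eweight i0 ix x0 iy y0.
  exists (x, a *: y, z) => _; split.
    by split=> //; apply: (subspaceZ a (root_space_subspace (- eps i)) iy).
  move=> k; have [nx ny] := nxy k; split=> // v /=.
  have [m em] := @scaled_nilpotent _ _ _ a (act_linearr rho _) ny v.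
  by exists m; rewrite -[RHS]em; apply: eq_iter => u;
    rewrite (linZ (act_mono_linear rho k u)).
have ri : Defs.roots (eps i).
  split; first exact/eqP.
  exists e`_i => // e0; have := coord_free i i (basis_free ebasis).
  by rewrite e0 linear0 eqxx => /eqP; rewrite eq_sym oner_eq0.
have [_ _ /(_ _ ri)[Qi|Qi]] := halpha.
  have pi : pos_roots alpha (eps i) by [].
  have [px p0 mx m0] := hx pi; exists (xp (eps i)), (xm (eps i)).
  by split; [split=> //; apply/eqP|split=> //; apply/eqP|move=> k; apply: intV.2].
have pi : pos_roots alpha (- eps i).
  by split=> //; apply: (opp_root hg hh ebasis eweight).
have [px p0 mx m0] := hx pi; rewrite opprK in mx.
exists (xm (- eps i)), (xp (- eps i)).
split; [by split=> //; apply/eqP|by split=> //; apply/eqP|move=> k].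
by have [] := intV.2 _ k pi.
Qed.

End Triples.

Local Open Scope complex_scope.

Theorem theorem1 (R : realType) (g : finLieAlgType R[i]) (hg : simple_lie g)
    (h : {vspace g}) (hh : cartan h)
    (I : finType) (alpha : I -> cdual h) (halpha : simple_roots alpha)
    (theta : cdual h) (htheta : highest_root alpha theta)
    (xp xm : cdual h -> g) (hx : root_vectors alpha xp xm)
    (V : lmodType R[i]) (rho : lie_action (loope g) V)
    (hV : Ifin alpha rho xp xm) :
  (exists (J : choiceType) (M : J -> set V),
     (forall j, indecomposable rho (M j)) /\ direct_sum setT M setT) /\
  exists U1 U2 : set V,
    [/\ submodule rho U1, submodule rho U2 & direct_sum2 U1 U2 setT] /\
    [/\ U1 `<=` annihilated rho (@Lg _ g),
        plus_part alpha theta rho U2 = plus_part alpha theta rho setT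
      & exists (n : nat) (M : 'I_n -> set V),
          (forall i, indecomposable rho (M i)) /\ direct_sum setT M U2].
Proof.
have [intV wPe fin] := hV; have wdec := intV.1.
have wint (l : ewt h) v : weight_space rho l v -> v != 0 -> exists k : int,
  l.2 = k%:~R.
  move=> lv v0; have [|_ //] := wPe l.
  by move=> l0; move: lv; rewrite l0 /= => v0'; rewrite v0' eqxx in v0.
have [n [e [eps [ebasis eweight]]]] := weight_basis hh.
have [X [Y [H XYH]]] := integrable_triples hg hh ebasis eweight halpha hx intV.
have triple i (i0 : eps i != 0) := (XYH i i0).1.
have nilp i (i0 : eps i != 0) := (XYH i i0).2.
have [S SP] := small_weights_finite hg hh ebasis eweight triple.
have meets M : submodule rho M -> ~ M `<=` invariants rho ->
    exists (l : ewt h) v, [/\ l \in [seq (mu, 0) : ewt h | mu <- S], M v,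
      v != 0 & weight_space rho l v].
  move=> mM ntM.
  have [mu [v [/SP muS Mv v0 lv]]] :=
    nontrivial_small_weight hg hh ebasis eweight wdec wint triple nilp mM ntM.
  by exists (mu, 0), v; split=> //; apply: map_f.
have [U1 [U2 [m1 m2 d12 U1K e2]]] := invariant_splitting wdec.
have [J [M1 [i1 dM1]]] := invariants_decomposition wdec m1 U1K.
have [k [M2 [i2 dM2]]] := essential_decomposition fin meets e2.
split.
  exists (J + 'I_k)%type, (sum_family M1 M2).
  have isum j : indecomposable rho (sum_family M1 M2 j) by case: j.
  split=> //; apply/seq_directP => [j|]; first by have [[]] := isum j.
  exact: seq_direct_sum (submodule_subspace m1) (submodule_subspace m2) d12 dM1 dM2.
exists U1, U2; split=> //; split=> //; last first.
  exists k, M2; split=> //; apply/seq_directP => // j.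
  by have [[]] := i2 j.
have sub (l : ewt h) : [/\ Pe_dom alpha l, ~ Zdelta l & 0 <= l.2 < r_wt theta l.1] ->
    U2 `&` weight_space rho l = setT `&` weight_space rho l.
  move=> [[_ l2] lZ _]; rewrite setTI; apply/setIidPr.
  apply: (weight_vector_summand m1 m2 d12 U1K).
  by apply/eqP => l1; apply: lZ.
by apply/seteqP; split=> v [f [ff fl] ->]; exists f => //; split=> // l /[dup] Dl /fl;
  rewrite (sub l Dl).
Qed.
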